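(* Let $X_1,\dots,X_n$ be i.i.d. with law $P$ on $(\mathcal X,\mathcal A)$, let $\mathscr C$ be a countable collection of measurable subsets of $\mathcal X$, and fix $\alpha>0$. Suppose that $\log\mathcal N_I(\epsilon,\mathscr C,P)\le L\epsilon^{-\alpha}$ for all $\epsilon>0$, and that $\sigma^2\gtrsim n^{-1/(\alpha+1)}$, $\alpha\ne1$. Then $$\mathbb E\sup_{C\in\mathscr C(\sigma)}|\mathbb G_n(C)|\lesssim_\alpha\max\big\{\sigma^{1-\alpha},\,n^{(\alpha-1)/(2(\alpha+1))}\big\}.$$ If furthermore $\log\mathcal N(\epsilon/4,\mathscr C(\sqrt\epsilon),P)\ge L^{-1}\epsilon^{-\alpha}$ for all $\epsilon>0$, then $$\mathbb E\sup_{C\in\mathscr C(\sigma)}|\mathbb G_n(C)|\gtrsim_\alpha\max\big\{\sigma^{1-\alpha},\,n^{(\alpha-1)/(2(\alpha+1))}\big\}.$$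
   Context: For measurable $C$, $\mathbb G_n(C)=n^{-1/2}\sum_{i=1}^n(\mathbf 1_C(X_i)-P(C))$. For any $\sigma>0$, $\mathscr C(\sigma)=\{C\in\mathscr C:P(C)\le\sigma^2\}$. $\mathcal N_I(\epsilon,\mathscr C,P)$ is the $\epsilon$-bracketing number of $\{\mathbf 1_C:C\in\mathscr C\}$ in $L_1(P)$: the minimum number of brackets $[\ell,u]=\{f:\ell\le f\le u\}$ with $\|u-\ell\|_{L_1(P)}<\epsilon$ needed to cover this class. $\mathcal N(\epsilon,\mathscr C,P)$ is the corresponding $\epsilon$-covering number: the minimum number of balls of radius $\epsilon$ needed to cover $\{\mathbf 1_C:C\in\mathscr C\}$ in $L_1(P)$. Notational convention: $\log(x)$ stands for $\log(e\vee x)$. $a\lesssim_\alpha b$ means $a\le C_\alpha b$ with $C_\alpha$ depending only on $\alpha$; $\gtrsim_\alpha$ is the reverse; without subscript the constant is absolute. $L$ is a large enough absolute constant, the dependence on which is not explicitly stated.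
   Formalization: In the lower bound, σ ≤ 1 is assumed when α < 1 (otherwise σ^{1-α} is unbounded while C(σ)=C(1)); in the bracketing entropy hypothesis log is the plain logarithm, since log(e∨·) ≤ Lε^{-α} cannot hold for all ε > 0. *)

(* Defs.v *)
From HB Require Import structures.
From mathcomp Require Import all_boot all_order all_algebra.
From mathcomp Require Import all_classical all_reals all_analysis.

Set Implicit Arguments.
Unset Strict Implicit.
Unset Printing Implicit Defensive.

Import Order.TTheory GRing.Theory Num.Theory.
Import numFieldNormedType.Exports.

Local Open Scope classical_set_scope.
Local Open Scope ring_scope.

Definition mutually_independent (R : realType) (dW : measure_display)
    (W : measurableType dW) (Pr : probability W R) (d : measure_display)
    (T : measurableType d) (n : nat) (X : 'I_n -> {RV Pr >-> T}) : Prop :=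
  forall (J : {set 'I_n}) (B : 'I_n -> set T),
    (forall i, measurable (B i)) ->
    Pr (\bigcap_(i in [set` J]) (X i @^-1` B i)) =
      (\prod_(i in J) Pr (X i @^-1` B i))%E.

Definition iid_with_law (R : realType) (dW : measure_display)
    (W : measurableType dW) (Pr : probability W R) (d : measure_display)
    (T : measurableType d) (P : probability T R) (n : nat)
    (X : 'I_n -> {RV Pr >-> T}) : Prop :=
  mutually_independent X /\
  forall i A, measurable A -> distribution Pr (X i) A = P A.

Definition emp_process (R : realType) (W : Type) (d : measure_display)
    (T : measurableType d) (P : probability T R) (n : nat)
    (X : 'I_n -> W -> T) (A : set T) (w : W) : R :=
  (Num.sqrt n%:R)^-1 * \sum_(i < n) (\1_A (X i w) - fine (P A)).

(* The classes {C : P(C) <= s2}; C(sigma) is the case s2 = sigma^2 and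
   C(sqrt eps) the case s2 = eps. *)
Definition subclass (R : realType) (d : measure_display)
    (T : measurableType d) (P : probability T R) (C : set (set T)) (s2 : R) :
    set (set T) :=
  [set A | C A /\ (P A <= s2%:E)%E].

(* The real supremum below is an honest one when n >= 1, since
   |G_n(A)| <= sqrt n; over the empty class it is 0. *)
Definition sup_emp_process (R : realType) (W : Type) (d : measure_display)
    (T : measurableType d) (P : probability T R) (n : nat)
    (X : 'I_n -> W -> T) (C : set (set T)) (w : W) : R :=
  sup [set `|emp_process P X A w| | A in C].

Definition bracket_cover (R : realType) (d : measure_display)
    (T : measurableType d) (P : probability T R) (C : set (set T)) (eps : R)
    (m : nat) : Prop :=
  exists l u : 'I_m -> T -> R,
    (forall i, [/\ l i \in Lfun P 1, u i \in Lfun P 1 &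
       ('N[P]_1[EFin \o (u i \- l i)%R] < eps%:E)%E]) /\
    (forall A, C A -> exists i, forall x, l i x <= \1_A x <= u i x).

(* The centres of the balls are arbitrary elements of L_1(P). *)
Definition ball_cover (R : realType) (d : measure_display)
    (T : measurableType d) (P : probability T R) (C : set (set T)) (eps : R)
    (m : nat) : Prop :=
  exists g : 'I_m -> T -> R,
    (forall i, g i \in Lfun P 1) /\
    (forall A, C A ->
       exists i, ('N[P]_1[EFin \o (\1_A \- g i)%R] < eps%:E)%E).

(* Both numbers are +oo when no finite cover exists. *)
Definition bracketing_number (R : realType) (d : measure_display)
    (T : measurableType d) (P : probability T R) (C : set (set T)) (eps : R) :
    \bar R :=
  ereal_inf [set (m%:R)%:E | m in [set m | bracket_cover P C eps m]].

Definition covering_number (R : realType) (d : measure_display)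
    (T : measurableType d) (P : probability T R) (C : set (set T)) (eps : R) :
    \bar R :=
  ereal_inf [set (m%:R)%:E | m in [set m | ball_cover P C eps m]].

(* log(x) := log(e \/ x) *)
Definition log_e (R : realType) (x : \bar R) : \bar R :=
  lne (maxe (expR 1)%:E x).

(* The plain logarithm is used here: log(e \/ N) >= 1 could never be
   <= L eps^(-alpha) for large eps.  For eps <= 1 <= L the two readings
   coincide, and for eps > 1 the single bracket [0, 1] gives lne 1 = 0. *)
Definition bracketing_entropy_bound (R : realType) (d : measure_display)
    (T : measurableType d) (P : probability T R) (C : set (set T))
    (L alpha : R) : Prop :=
  forall eps : R, 0 < eps ->
    (lne (bracketing_number P C eps) <= (L * eps `^ (- alpha))%:E)%E.

(* Here the convention log_e matters: for eps > 4 the covering number is at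
   most 1. *)
Definition covering_entropy_lower_bound (R : realType) (d : measure_display)
    (T : measurableType d) (P : probability T R) (C : set (set T))
    (L alpha : R) : Prop :=
  forall eps : R, 0 < eps ->
    ((L^-1 * eps `^ (- alpha))%:E <=
       log_e (covering_number P (subclass P C eps) (eps / 4)))%E.

Definition rate (R : realType) (alpha sigma : R) (n : nat) : R :=
  Num.max (sigma `^ (1 - alpha))
          (n%:R `^ ((alpha - 1) / (2 * (alpha + 1)))).

(* Main.v *)
(* The reduction is to finite probability spaces: the X_i enter only through
   the indicators of finitely many sets, i.e. through i.i.d. samples from a
   finite set of 0/1 patterns, so every expectation is a finite sum.

   Upper bound.  Replace the brackets [l, u] by sets, {l > 0} and {u >= 1}, and
   chain along dyadic scales from g = n^(-1/(alpha+1)) up to sigma^2.  At each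
   scale e >= g the entropy e^(-alpha) is at most n e, so Bernstein's inequality
   is in its Gaussian regime and costs e^((1-alpha)/2); the geometric sum is
   dominated by one of its two ends.  The remainder at the scale g is controlled
   by bracketing, at the cost of the bias n^(1/2) g, which has the same order.

   Lower bound.  Take a maximal packing of {C : P(C) <= eps} at distance eps/4.
   The diameter is comparable with the separation, so a Sudakov minoration
   follows from a multiple hypothesis testing argument: under the tilts of P by
   the sets of the packing, the largest corrected empirical sum would identify
   the tilt if the empirical process were small.  Take eps of order sigma^2
   when alpha < 1 and of order g when alpha > 1. *)

Require Import Defs.
From HB Require Import structures.
From mathcomp Require Import all_boot all_order all_algebra.
From mathcomp Require Import all_classical all_reals all_analysis.
From mathcomp Require Import measurable_realfun ring lra.

Set Implicit Arguments.
Unset Strict Implicit.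
Unset Printing Implicit Defensive.

Import Order.TTheory GRing.Theory Num.Theory.
Import numFieldNormedType.Exports.

Local Open Scope classical_set_scope.
Local Open Scope ring_scope.

(** * Expectations over finite product spaces *)

(** The weights may vary with the coordinate: given a sample [x], its resampled version has
    marginals [K (x i)]. *)
Definition Eprod (R : realType) (n : nat) (S : finType) (w : 'I_n -> S -> R)
    (F : {ffun 'I_n -> S} -> R) : R :=
  \sum_(y : {ffun 'I_n -> S}) (\prod_i w i (y i)) * F y.

Definition is_pmf (R : realType) (S : finType) (p : S -> R) : Prop :=
  (forall s, 0 <= p s) /\ \sum_s p s = 1.

Lemma Eprod_prod (R : realType) (n : nat) (S : finType) (w g : 'I_n -> S -> R) :
  Eprod w (fun y => \prod_i g i (y i)) = \prod_i \sum_s w i s * g i s.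
Proof.
by rewrite bigA_distr_bigA; apply: eq_bigr => y _; rewrite -big_split.
Qed.

Lemma Eprod_le (R : realType) (n : nat) (S : finType) (w : 'I_n -> S -> R)
    (F G : {ffun 'I_n -> S} -> R) :
  (forall i s, 0 <= w i s) -> (forall y, F y <= G y) -> Eprod w F <= Eprod w G.
Proof.
move=> w0 FG; apply: ler_sum => y _; apply: ler_wpM2l => //.
exact: prodr_ge0.
Qed.

Lemma EprodD (R : realType) (n : nat) (S : finType) (w : 'I_n -> S -> R)
    (F G : {ffun 'I_n -> S} -> R) :
  Eprod w (fun y => F y + G y) = Eprod w F + Eprod w G.
Proof. by rewrite -big_split; apply: eq_bigr => y _; rewrite mulrDr. Qed.

Lemma EprodZ (R : realType) (n : nat) (S : finType) (w : 'I_n -> S -> R)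
    (c : R) (F : {ffun 'I_n -> S} -> R) :
  Eprod w (fun y => c * F y) = c * Eprod w F.
Proof. by rewrite mulr_sumr; apply: eq_bigr => y _; rewrite mulrCA. Qed.

Lemma Eprod_sum (R : realType) (n : nat) (S : finType) (w : 'I_n -> S -> R)
    (J : finType) (F : J -> {ffun 'I_n -> S} -> R) :
  Eprod w (fun y => \sum_j F j y) = \sum_j Eprod w (F j).
Proof.
by rewrite exchange_big; apply: eq_bigr => y _; rewrite mulr_sumr.
Qed.

Lemma Eprod_cst (R : realType) (n : nat) (S : finType) (w : 'I_n -> S -> R)
    (c : R) :
  (forall i, \sum_s w i s = 1) -> Eprod w (fun=> c) = c.
Proof.
move=> w1; rewrite /Eprod -mulr_suml -(bigA_distr_bigA w).
by under eq_bigr do rewrite w1; rewrite big1_eq mul1r.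
Qed.

Lemma Eprod_coord (R : realType) (n : nat) (S : finType) (w : 'I_n -> S -> R)
    (i : 'I_n) (f : S -> R) :
  (forall i, \sum_s w i s = 1) ->
  Eprod w (fun y => f (y i)) = \sum_s w i s * f s.
Proof.
move=> w1.
transitivity (Eprod w (fun y => \prod_j if j == i then f (y j) else 1)).
  by apply: eq_bigr => y _; rewrite -big_mkcond big_pred1_eq.
rewrite (Eprod_prod w (fun j s => if j == i then f s else 1)) (bigD1 i)//= eqxx.
rewrite [X in _ * X]big1 ?mulr1// => j /negPf ->.
by under eq_bigr do rewrite mulr1; exact: w1.
Qed.

Lemma Eprod_coord_sum (R : realType) (n : nat) (S : finType)
    (w : 'I_n -> S -> R) (f : S -> R) :
  (forall i, \sum_s w i s = 1) ->
  Eprod w (fun y => \sum_i f (y i)) = \sum_i \sum_s w i s * f s.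
Proof.
move=> w1; rewrite Eprod_sum.
by apply: eq_bigr => i _; exact: Eprod_coord.
Qed.

Lemma Eprod_abs (R : realType) (n : nat) (S : finType) (w : 'I_n -> S -> R)
    (F : {ffun 'I_n -> S} -> R) :
  (forall i s, 0 <= w i s) -> `|Eprod w F| <= Eprod w (fun y => `|F y|).
Proof.
move=> w0; apply: le_trans (ler_norm_sum _ _ _) _; apply: ler_sum => y _.
by rewrite normrM ger0_norm// prodr_ge0.
Qed.

(** * Exponential moments and maxima of finitely many sums *)

(** From [1 - x <= expR (- x)] comes [(1 - x) * expR x <= 1], and [(1 + x + 2 x^2)(1 - x) = 1 + x^2
    (1 - 2 x)] is at least 1. *)
Lemma expR_le_quadratic (R : realType) (x : R) :
  x <= 2^-1 -> expR x <= 1 + x + 2 * x ^+ 2.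
Proof.
move=> xle; have := expR_ge1Dx (- x); rewrite expRN => h.
have e0 := expR_gt0 x; have {}h : (1 - x) * expR x <= 1.
  by rewrite -ler_pdivlMr// mul1r.
have x2 : 0 <= x ^+ 2 by exact: sqr_ge0.
have h2 : 1 <= (1 + x + 2 * x ^+ 2) * (1 - x) by nra.
rewrite -(@ler_pM2r _ (1 - x)); last by lra.
by rewrite mulrC; apply: le_trans h h2.
Qed.

(** Bernstein's bound in its Gaussian range: the expectation factorises over the coordinates, and
    [|f| <= 1] gives [f^2 <= |f|], so the [L_1] bound [v] also controls the variance. *)
Lemma Eprod_mgf (R : realType) (n : nat) (S : finType) (p : S -> R)
    (f : S -> R) (v t : R) :
  is_pmf p -> (forall s, `|f s| <= 1) -> \sum_s p s * `|f s| <= v ->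
  `|t| <= 4^-1 ->
  Eprod (fun _ : 'I_n => p)
    (fun y => expR (t * \sum_i (f (y i) - \sum_s p s * f s))) <=
  expR (2 * n%:R * v * t ^+ 2).
Proof.
move=> [p0 p1] f1 fv t4; set m := \sum_s p s * f s.
have m1 : `|m| <= 1.
  apply: le_trans (ler_norm_sum _ _ _) _; rewrite -p1; apply: ler_sum => s _.
  by rewrite normrM ger0_norm// ler_piMr.
rewrite (_ : Eprod _ _ = \prod_(i < n) \sum_s p s * expR (t * (f s - m))); last first.
  rewrite -(Eprod_prod (fun _ : 'I_n => p) (fun=> fun s => expR (t * (f s - m)))).
  by apply: eq_bigr => y _; rewrite mulr_sumr expR_sum.
rewrite prodr_const card_ord.
rewrite (_ : 2 * _ * _ * _ = n%:R * (2 * v * t ^+ 2)); last by ring.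
rewrite expRM_natl; apply: lerXn2r; rewrite ?nnegrE ?expR_ge0//.
  by apply: sumr_ge0 => s _; rewrite mulr_ge0// expR_ge0.
apply: le_trans (expR_ge1Dx _).
have step s : p s * expR (t * (f s - m)) <=
    p s + t * (p s * f s - m * p s) +
    2 * t ^+ 2 * (p s * `|f s| - 2 * m * (p s * f s) + m ^+ 2 * p s).
  have : expR (t * (f s - m)) <= 1 + t * (f s - m) + 2 * (t * (f s - m)) ^+ 2.
    apply: expR_le_quadratic; apply: le_trans (ler_norm _) _; rewrite normrM.
    have : `|f s - m| <= 2.
      by apply: le_trans (ler_normB _ _) _; have := f1 s; lra.
    by move: (normr_ge0 (f s - m)) (normr_ge0 t); nra.
  move/(ler_wpM2l (p0 s)) => /le_trans; apply.
  rewrite -subr_ge0.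
  have -> : p s + t * (p s * f s - m * p s) +
    2 * t ^+ 2 * (p s * `|f s| - 2 * m * (p s * f s) + m ^+ 2 * p s) -
    p s * (1 + t * (f s - m) + 2 * (t * (f s - m)) ^+ 2) =
    2 * t ^+ 2 * p s * (`|f s| - f s ^+ 2) by ring.
  rewrite mulr_ge0 ?subr_ge0//; first by rewrite mulr_ge0// mulr_ge0 ?sqr_ge0.
  by rewrite -real_normK ?num_real// expr2 ler_piMr.
apply: le_trans (ler_sum _ (fun s _ => step s)) _.
rewrite !big_split/= p1 -!mulr_sumr sumrB big_split/= sumrB -!mulr_sumr p1 -/m.
rewrite -addrA lerD2l mulr1 subrr mulr0 add0r.
have -> : 2 * v * t ^+ 2 = 2 * t ^+ 2 * v by ring.
apply: ler_wpM2l; first by rewrite mulr_ge0// sqr_ge0.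
apply: le_trans fv; move: (sqr_ge0 m); nra.
Qed.

(* [h + e^(x - h) - 1 >= x] replaces the maximum by a sum of exponentials
   without any appeal to Jensen's inequality. *)
Lemma Eprod_maximal (R : realType) (n : nat) (S : finType) (p : S -> R)
    (I : finType) (f : I -> S -> R) (v t h : R) :
  is_pmf p -> (forall i s, `|f i s| <= 1) ->
  (forall i, \sum_s p s * `|f i s| <= v) ->
  0 < t -> t <= 4^-1 -> 1 <= h ->
  2 * #|I|%:R * expR (2 * n%:R * v * t ^+ 2) <= expR h ->
  exists Phi : {ffun 'I_n -> S} -> R, [/\ forall y, 0 <= Phi y,
    Eprod (fun=> p) Phi <= h / t &
    forall (y : {ffun 'I_n -> S}) i, `|\sum_k (f i (y k) - \sum_s p s * f i s)| <= Phi y].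
Proof.
move=> pp f1 fv t0 t4 h1 hI; have [p0 p1] := pp.
pose Z i (y : {ffun 'I_n -> S}) := \sum_k (f i (y k) - \sum_s p s * f i s).
pose Psi y := \sum_i (expR (t * Z i y - h) + expR ((- t) * Z i y - h)).
have Psi0 y : 0 <= Psi y by apply: sumr_ge0 => i _; rewrite addr_ge0// expR_ge0.
exists (fun y => t^-1 * (h - 1 + Psi y)); split.
- by move=> y; rewrite mulr_ge0 ?invr_ge0 ?(ltW t0)// addr_ge0// subr_ge0.
- rewrite EprodZ EprodD Eprod_cst// mulrC ler_wpM2r ?invr_ge0 ?(ltW t0)//.
  suff : Eprod (fun=> p) Psi <= 1 by lra.
  rewrite Eprod_sum.
  have hi i : Eprod (fun _ : 'I_n => p)
        (fun y => expR (t * Z i y - h) + expR (- t * Z i y - h))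
      <= 2 * expR (2 * n%:R * v * t ^+ 2) / expR h.
    rewrite EprodD.
    have sg (s : R) : `|s| <= 4^-1 ->
        Eprod (fun=> p) (fun y => expR (s * Z i y - h)) <=
        expR (2 * n%:R * v * s ^+ 2) / expR h.
      move=> s4; have := Eprod_mgf n pp (f1 i) (fv i) s4.
      rewrite (_ : Eprod _ (fun y => expR (s * Z i y - h)) = (expR h)^-1 *
        Eprod (fun=> p) (fun y => expR (s * Z i y))); last first.
        by rewrite -EprodZ; apply: eq_bigr => y _; rewrite expRB [_ / expR h]mulrC.
      by move=> le; rewrite mulrC ler_wpM2r// invr_ge0 expR_ge0.
    have := sg t; have := sg (- t); rewrite normrN ger0_norm ?(ltW t0)// sqrrN.
    by move=> /(_ t4) ? /(_ t4) ?; lra.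
  apply: le_trans (ler_sum _ (fun i _ => hi i)) _.
  rewrite sumr_const -[_ *+ #|_|]mulr_natl mulrA ler_pdivrMr ?expR_gt0// mul1r.
  by apply: le_trans hI; rewrite mulrA [_ * 2]mulrC.
- move=> y i; rewrite -/(Z i y) mulrC ler_pdivlMr//.
  have Psile : expR (t * Z i y - h) + expR (- t * Z i y - h) <= Psi y.
    rewrite /Psi (bigD1 i)//= lerDl; apply: sumr_ge0 => j _.
    by rewrite addr_ge0// expR_ge0.
  have [Z0|Z0] := leP 0 (Z i y).
    rewrite ger0_norm// mulrC; have := expR_ge1Dx (t * Z i y - h).
    by have := expR_ge0 (- t * Z i y - h); lra.
  rewrite ltr0_norm// mulrC; have := expR_ge1Dx (- t * Z i y - h).
  by have := expR_ge0 (t * Z i y - h); lra.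
Qed.

(** * Change of law and Sudakov minoration *)

(** Tower property: resampling every coordinate independently through [K] turns a product law into
    the product of the image laws, by distributing the product over the sums. *)
Lemma Eprod_kernel (R : realType) (n : nat) (S : finType) (w : 'I_n -> S -> R)
    (K : S -> S -> R) (F : {ffun 'I_n -> S} -> R) :
  Eprod w (fun x => Eprod (fun i => K (x i)) F) =
  Eprod (fun i s => \sum_a w i a * K a s) F.
Proof.
rewrite /Eprod; under eq_bigr do rewrite mulr_sumr.
rewrite exchange_big; apply: eq_bigr => y _.
rewrite bigA_distr_bigA mulr_suml; apply: eq_bigr => x _.
by rewrite mulrA -big_split.
Qed.

(* The kernel that keeps a point with probability 1/2 and otherwise resamples
   it from 2p - q maps q to p, and the q-centred sum is the conditional
   expectation of twice the p-centred sum, so Jensen's inequality applies. *)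
Lemma Eprod_change_pmf (R : realType) (n : nat) (S : finType) (p q : S -> R)
    (I : Type) (f : I -> S -> R) (F : {ffun 'I_n -> S} -> R) :
  is_pmf p -> is_pmf q -> (forall s, q s <= 2 * p s) ->
  (forall (y : {ffun 'I_n -> S}) i,
     `|\sum_k (f i (y k) - \sum_s p s * f i s)| <= F y) ->
  exists2 G : {ffun 'I_n -> S} -> R,
    Eprod (fun=> q) G = 2 * Eprod (fun=> p) F &
    forall (y : {ffun 'I_n -> S}) i,
      `|\sum_k (f i (y k) - \sum_s q s * f i s)| <= G y.
Proof.
move=> [p0 p1] [q0 q1] qp fF.
pose K a s : R := 2^-1 * (s == a)%:R + 2^-1 * (2 * p s - q s).
have K0 a s : 0 <= K a s.
  rewrite addr_ge0// mulr_ge0 ?invr_ge0// subr_ge0; exact: qp.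
have K1 a : \sum_s K a s = 1.
  rewrite big_split/= -!mulr_sumr sumrB -mulr_sumr p1 q1.
  rewrite (bigD1 a)//= eqxx/= big1 ?addr0 => [|s /negPf ->//].
  by lra.
exists (fun x => 2 * Eprod (fun i => K (x i)) F).
  rewrite EprodZ Eprod_kernel; congr (_ * _); apply: eq_bigr => y _.
  congr (_ * _); apply: eq_bigr => i _.
  transitivity (\sum_a (2^-1 * (q a * (y i == a)%:R) +
    q a * (2^-1 * (2 * p (y i) - q (y i))))).
    by apply: eq_bigr => a _; rewrite mulrDr mulrCA.
  rewrite big_split/= -mulr_sumr (bigD1 (y i))//= eqxx/= big1 ?addr0; last first.
    by move=> s; rewrite eq_sym => /negPf ->; rewrite mulr0.
  rewrite -!mulr_suml q1 mulr1 mul1r; lra.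
move=> x i; set m := \sum_s p s * f i s.
have -> : \sum_k (f i (x k) - \sum_s q s * f i s) =
    2 * Eprod (fun k => K (x k)) (fun y => \sum_k (f i (y k) - m)).
  rewrite (Eprod_coord_sum (fun s => f i s - m))// mulr_sumr.
  apply: eq_bigr => k _.
  transitivity (2 * \sum_s (2^-1 * ((s == x k)%:R * f i s) + (p s * f i s -
     2^-1 * (q s * f i s)) - m * K (x k) s)); last first.
    by congr (_ * _); apply: eq_bigr => s _; rewrite /K; lra.
  rewrite sumrB -mulr_sumr K1 big_split/= -mulr_sumr sumrB -mulr_sumr -/m.
  rewrite [\sum_s (_ == _)%:R * _](bigD1 (x k))//= eqxx/=.
  rewrite [\sum_(_ | _ != _) _]big1 ?addr0; last first.
    by move=> s /negPf ->; rewrite mul0r.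
  by lra.
rewrite normrM ger0_norm//; apply: ler_wpM2l => //.
by apply: le_trans (Eprod_abs _ _) _ => //; apply: Eprod_le.
Qed.

(* Sudakov minoration by hypothesis testing: tilt p by 1 + lam (f_j - p f_j)
   and try to recover j from the largest corrected empirical sum.  The M decision
   regions are disjoint, so one of them has small mass under the untilted law,
   and hence mass at most 1/2 under its own tilted law; outside it the centred
   sums are large. *)
Lemma Eprod_sudakov (R : realType) (n M : nat) (S : finType) (p : S -> R)
    (f : 'I_M -> S -> R) (eps lam : R) (F : {ffun 'I_n -> S} -> R) :
  is_pmf p -> (forall k s, 0 <= f k s <= 1) ->
  (forall k, \sum_s p s * f k s <= eps) ->
  (forall j k, j != k -> eps / 4 <= \sum_s p s * (f j s - f k s) ^+ 2) ->
  0 <= eps <= 8^-1 -> 0 <= lam <= 1 ->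
  expR (n%:R * lam ^+ 2 * eps) <= M%:R / 4 ->
  (forall (y : {ffun 'I_n -> S}) k,
     `|\sum_i (f k (y i) - \sum_s p s * f k s)| <= F y) ->
  n%:R * lam * eps / 128 <= Eprod (fun=> p) F.
Proof.
move=> pp f01 feps fsep /andP[eps0 eps8] /andP[lam0 lam1] expM fF.
have [p0 p1] := pp.
pose m k := \sum_s p s * f k s; pose g k s := f k s - m k.
have m01 k : 0 <= m k <= 1.
  apply/andP; split; first by apply: sumr_ge0 => s _; have := f01 k s; have := p0 s; nra.
  by have := feps k; rewrite -/(m k); lra.
have g1 k s : -1 <= g k s <= 1 by have := f01 k s; have := m01 k; rewrite /g; lra.
have pg k : \sum_s p s * g k s = 0.
  by under eq_bigr do rewrite mulrBr; rewrite sumrB -mulr_suml p1 mul1r subrr.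
pose C k j := \sum_s p s * (g k s * g j s).
pose Z k (y : {ffun 'I_n -> S}) := \sum_i g k (y i).
(* Under the tilt by [j], [Z k] has mean [n * lam * C k j]. The correction makes the mean of
   [th k - th j] equal to [- n * lam / 2] times the variance of [f k - f j], so that [j] should
   win. *)
pose th k y := Z k y - n%:R * lam * C k k / 2.
pose hit j y := [forall k, (k != j) ==> (th k y < th j y)].
have M0 : 0 < M%:R :> R by have := expR_gt0 (n%:R * lam ^+ 2 * eps); lra.
(* The strict inequality in [hit] makes the regions disjoint, so their masses add up to at most 1
   and one of them is at most the average. *)
have [j Pj] : exists j, Eprod (fun=> p) (fun y => (hit j y)%:R) <= M%:R^-1.
  apply/not_existsP => nP.
  have : \sum_(j < M) M%:R^-1 < \sum_(j < M) Eprod (fun=> p) (fun y => (hit j y)%:R).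
    apply: ltr_sum; last by move=> j _; rewrite ltNge; exact/negP/nP.
    have Mpos : (0 < M)%N by rewrite -(ltr0n R).
    by apply/hasP; exists (Ordinal Mpos); rewrite ?mem_index_enum.
  apply/negP; rewrite -leNgt sumr_const card_ord -[_ *+ M]mulr_natr mulVf ?gt_eqF//.
  rewrite -Eprod_sum -[leRHS](@Eprod_cst _ n _ (fun=> p))//; apply: Eprod_le => // y.
  have [[j hj]|nh] := pselect (exists j, hit j y); last first.
    by rewrite big1// => j _; case: (boolP (hit j y)) => // hj; case: nh; exists j.
  rewrite (bigD1 j)//= hj big1 ?addr0// => k kj.
  case: (boolP (hit k y)) => // /forallP/(_ j); rewrite eq_sym kj/=.
  by move: hj => /forallP/(_ k); rewrite kj/= => /lt_trans h /h; rewrite ltxx.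
pose q s := p s * (1 + lam * g j s).
have q0 s : 0 <= q s by rewrite mulr_ge0//; have := g1 j s; nra.
have q1 : \sum_s q s = 1.
  transitivity (\sum_s (p s + lam * (p s * g j s))).
    by apply: eq_bigr => s _; rewrite /q; ring.
  by rewrite big_split/= -mulr_sumr pg p1; ring.
have qf k : \sum_s q s * f k s = m k + lam * C k j.
  transitivity (\sum_s (p s * f k s + lam * (p s * (g k s * g j s)) +
      lam * m k * (p s * g j s))).
    by apply: eq_bigr => s _; rewrite /q /g; ring.
  by rewrite !big_split/= -!mulr_sumr pg -/(m k) -/(C k j); ring.
have CV k : C k k <= eps.
  apply: le_trans (feps k).
  have -> : C k k = \sum_s (p s * f k s ^+ 2 - m k * (p s * g k s) - m k * (p s * f k s)).
    by apply: eq_bigr => s _; rewrite /g; ring.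
  rewrite !sumrB -!mulr_sumr pg -/(m k) mulr0 subr0.
  apply: le_trans (_ : \sum_s p s * f k s ^+ 2 <= _).
    by have := m01 k; nra.
  by apply: ler_sum => s _; apply: ler_wpM2l => //; have := f01 k s; nra.
(* Both means lie in [[0, eps]], so subtracting the square of their difference costs at most
   [eps ^+ 2 <= eps / 8]. *)
have Csep k : k != j -> eps / 8 <= C k k + C j j - 2 * C k j.
  move=> kj.
  have -> : C k k + C j j - 2 * C k j =
      \sum_s p s * (f k s - f j s) ^+ 2 - (m k - m j) ^+ 2.
    transitivity (\sum_s (p s * (f k s - f j s) ^+ 2 -
        (m k - m j) * (p s * f k s - p s * f j s)
        - (m k - m j) * (p s * g k s - p s * g j s))).
      rewrite /C mulr_sumr -big_split/= -sumrB; apply: eq_bigr => s _.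
      by rewrite /g; ring.
    rewrite !sumrB -!mulr_sumr !sumrB !pg -/(m k) -/(m j); ring.
  have := fsep _ _ kj; have := feps k; have := feps j.
  by rewrite -/(m k) -/(m j); have := m01 k; have := m01 j; nra.
(* [D] is the likelihood ratio. In [D * hit <= D^2 / M + M / 4 * hit] each term on the right has
   mean at most 1/4, the first because [D^2] has mean at most [expR (n * lam^2 * eps)]. *)
have Qhit : Eprod (fun=> q) (fun y => (hit j y)%:R) <= 2^-1.
  pose D (y : {ffun 'I_n -> S}) := \prod_i (1 + lam * g j (y i)).
  have -> : Eprod (fun=> q) (fun y => (hit j y)%:R) =
      Eprod (fun=> p) (fun y => D y * (hit j y)%:R).
    by apply: eq_bigr => y _; rewrite big_split/= -mulrA.
  apply: (@le_trans _ _ (Eprod (fun=> p)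
      (fun y => M%:R^-1 * D y ^+ 2 + M%:R / 4 * (hit j y)%:R))).
    apply: Eprod_le => // y; case: (hit j y); last first.
      by rewrite !mulr0 addr0 mulr_ge0 ?sqr_ge0 ?invr_ge0 ?(ltW M0).
    rewrite !mulr1 -(ler_pM2l M0) mulrDr mulrA mulfV ?gt_eqF// mul1r.
    by have := sqr_ge0 (D y - M%:R / 2); lra.
  rewrite EprodD !EprodZ.
  have -> : Eprod (fun=> p) (fun y => D y ^+ 2) =
      \prod_(i < n) \sum_s p s * (1 + lam * g j s) ^+ 2.
    rewrite -(Eprod_prod (fun _ : 'I_n => p) (fun=> fun s => (1 + lam * g j s) ^+ 2)).
    by apply: eq_bigr => y _; rewrite prodrXl.
  have -> : \sum_s p s * (1 + lam * g j s) ^+ 2 = 1 + lam ^+ 2 * C j j.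
    transitivity (\sum_s (p s + 2 * lam * (p s * g j s) +
        lam ^+ 2 * (p s * (g j s * g j s)))).
      by apply: eq_bigr => s _; ring.
    by rewrite !big_split/= -!mulr_sumr pg p1 -/(C j j); ring.
  rewrite prodr_const card_ord.
  have : (1 + lam ^+ 2 * C j j) ^+ n <= M%:R / 4.
    apply: le_trans expM; rewrite -mulrA expRM_natl.
    have Cjj : 0 <= C j j.
      by apply: sumr_ge0 => s _; rewrite mulr_ge0// -expr2 sqr_ge0.
    apply: lerXn2r; rewrite ?nnegrE ?expR_ge0//.
      by rewrite addr_ge0// mulr_ge0// sqr_ge0.
    by apply: le_trans (expR_ge1Dx _); rewrite lerD2l ler_wpM2l ?sqr_ge0.
  move=> h1; have h2 : M%:R^-1 * (1 + lam ^+ 2 * C j j) ^+ n <= 4^-1.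
    by rewrite mulrC ler_pdivrMr// [4^-1 * _]mulrC.
  have : M%:R / 4 * Eprod (fun=> p) (fun y => (hit j y)%:R) <= 4^-1.
    by have := ler_wpM2l (ltW M0) Pj; rewrite mulfV ?gt_eqF//; lra.
  by lra.
have pq s : q s <= 2 * p s.
  have lg : lam * g j s <= 1 by have := g1 j s; nra.
  by rewrite /q; have := p0 s; nra.
have [G EG FG] := Eprod_change_pmf pp (conj q0 q1) pq fF.
suff : n%:R * lam * eps / 64 <= Eprod (fun=> q) G by rewrite EG; lra.
(* Outside the region some [k] has [th k >= th j]; the centred sums of [k] and [j] then differ by at
   least [n * lam * eps / 16], and one of them reaches half of that in absolute value. *)
set c := n%:R * lam * eps / 32.
apply: (@le_trans _ _ (Eprod (fun=> q) (fun y => c + (- c) * (hit j y)%:R))).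
  rewrite EprodD Eprod_cst// EprodZ.
  have c0 : 0 <= c by rewrite /c mulr_ge0// ?invr_ge0// !mulr_ge0.
  by have := ler_wpM2l c0 Qhit; rewrite /c; lra.
apply: Eprod_le => // y; have G0 : 0 <= G y by apply: le_trans (FG y j).
case: (boolP (hit j y)) => [_|]; first by rewrite mulr1 subrr.
rewrite mulr0 addr0 => /forallPn[k]; rewrite negb_imply -leNgt => /andP[kj thk].
have Zq i : \sum_k (f i (y k) - \sum_s q s * f i s) = Z i y - n%:R * lam * C i j.
  rewrite qf sumrB sumr_const card_ord /Z sumrB sumr_const card_ord.
  by rewrite -[(_ + _) *+ n]mulr_natl -[m i *+ n]mulr_natl; ring.
have := FG y k; have := FG y j; rewrite !Zq => /ler_normlP[Gj1 Gj2] /ler_normlP[Gk1 Gk2].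
have := Csep _ kj; move: thk; rewrite /th /c => thk cs.
have nl0 : 0 <= n%:R * lam by rewrite mulr_ge0.
by have := ler_wpM2l nl0 cs; lra.
Qed.

(** * Patterns of finitely many sets *)

Lemma comp_finType_indic (R : realType) (W : Type) (S : finType) (Y : W -> S)
    (F : S -> R) (w : W) :
  F (Y w) = \sum_s F s * \1_(Y @^-1` [set s]) w.
Proof.
rewrite (bigD1 (Y w))//= indicE mem_set// mulr1 big1 ?addr0// => s sY.
by rewrite indicE memNset ?mulr0//= => Ys; rewrite Ys eqxx in sY.
Qed.

Lemma measurable_comp_finType (R : realType) (d : measure_display)
    (W : measurableType d) (S : finType) (Y : W -> S) (F : S -> R) :
  (forall s, measurable (Y @^-1` [set s])) ->
  measurable_fun setT (fun w => F (Y w)).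
Proof.
move=> mY; rewrite (_ : (fun w => F (Y w)) =
    fun w => \sum_s F s * \1_(Y @^-1` [set s]) w); last first.
  by apply/funext => w; exact: comp_finType_indic.
apply: measurable_sum => s; apply: measurable_funM; first exact: measurable_cst.
exact: measurable_indic.
Qed.

Lemma integral_comp_finType (R : realType) (d : measure_display)
    (W : measurableType d) (Pr : probability W R) (S : finType) (Y : W -> S)
    (F : S -> R) :
  (forall s, measurable (Y @^-1` [set s])) -> (forall s, 0 <= F s) ->
  (\int[Pr]_w (F (Y w))%:E =
    (\sum_s fine (Pr (Y @^-1` [set s])) * F s)%:E)%E.
Proof.
move=> mY F0.
transitivity (\int[Pr]_w (\sum_(s : S) ((F s)%:E * (\1_(Y @^-1` [set s]) w)%:E)))%E.
  by apply: eq_integral => w _; rewrite (comp_finType_indic Y) -sumEFin.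
have m1 s : measurable_fun setT (fun w => (\1_(Y @^-1` [set s]) w)%:E).
  by apply/measurable_EFinP; exact: measurable_indic.
rewrite ge0_integral_sum//; last 2 first.
- by move=> s; apply: emeasurable_funM => //; exact: measurable_cst.
- by move=> s w _; rewrite mule_ge0// lee_fin.
rewrite -sumEFin; apply: eq_bigr => s _.
rewrite ge0_integralZl ?lee_fin//.
by rewrite integral_indic// setIT EFinM fineK ?fin_num_measure// muleC.
Qed.

(** A point is sent to its atom in the finite algebra generated by the [B i]; every [\1_(B i)]
    factors through this map. *)
Definition pattern (T : Type) (I : finType) (B : I -> set T) (x : T) :
    {ffun I -> bool} :=
  [ffun i => `[< B i x >]].

Definition pattern_pmf (R : realType) (d : measure_display)
    (T : measurableType d) (P : probability T R) (I : finType)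
    (B : I -> set T) (s : {ffun I -> bool}) : R :=
  fine (P (pattern B @^-1` [set s])).

Lemma indic_pattern (R : realType) (T : Type) (I : finType) (B : I -> set T)
    (i : I) (x : T) : \1_(B i) x = (pattern B x i)%:R :> R.
Proof.
rewrite ffunE indicE.
by case: asboolP => h; [rewrite mem_set|rewrite memNset].
Qed.

Lemma measurable_pattern (d : measure_display) (T : measurableType d)
    (I : finType) (B : I -> set T) (s : {ffun I -> bool}) :
  (forall i, measurable (B i)) -> measurable (pattern B @^-1` [set s]).
Proof.
move=> mB.
rewrite (_ : _ @^-1` _ = \bigcap_i (if s i then B i else ~` B i)).
  apply: fin_bigcap_measurable; first exact: finite_finset.
  by move=> i _; case: (s i) => //; exact: measurableC.
apply/seteqP; split => x /=.
  by move=> <- i _; rewrite ffunE; case: asboolP.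
move=> h; apply/ffunP => i; rewrite ffunE; have := h i Logic.I.
by case: (s i) => ?; [exact/asboolP|exact/asboolPn].
Qed.

Lemma expectation_pattern (R : realType) (d : measure_display)
    (T : measurableType d) (P : probability T R) (I : finType)
    (B : I -> set T) (F : {ffun I -> bool} -> R) :
  (forall i, measurable (B i)) -> (forall s, 0 <= F s) ->
  (\int[P]_x (F (pattern B x))%:E = (\sum_s pattern_pmf P B s * F s)%:E)%E.
Proof.
by move=> mB F0; apply: integral_comp_finType => // s; exact: measurable_pattern.
Qed.

Lemma pattern_pmfP (R : realType) (d : measure_display)
    (T : measurableType d) (P : probability T R) (I : finType)
    (B : I -> set T) :
  (forall i, measurable (B i)) -> is_pmf (pattern_pmf P B).
Proof.
move=> mB; split=> [s|]; first exact: fine_ge0.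
have := @expectation_pattern R d T P I B (fun=> 1) mB (fun=> ler01).
rewrite integral_cst// mul1e => PT; apply: EFin_inj.
under eq_bigr do rewrite -[pattern_pmf _ _ _]mulr1.
by rewrite -PT; exact: probability_setT.
Qed.

Lemma pattern_pmf_indic (R : realType) (d : measure_display)
    (T : measurableType d) (P : probability T R) (I : finType)
    (B : I -> set T) (i : I) :
  (forall i, measurable (B i)) ->
  \sum_s pattern_pmf P B s * (s i)%:R = fine (P (B i)).
Proof.
move=> mB; apply: EFin_inj.
rewrite -(@expectation_pattern _ _ _ P _ B (fun s => (s i)%:R)) => [| // |s];
  last exact: ler0n.
under eq_integral do rewrite -indic_pattern.
by rewrite integral_indic// setIT fineK// fin_num_measure.
Qed.

Definition sample_pattern (W T : Type) (n : nat) (X : 'I_n -> W -> T)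
    (I : finType) (B : I -> set T) (w : W) : {ffun 'I_n -> {ffun I -> bool}} :=
  [ffun k => pattern B (X k w)].

Lemma sample_patternE (R : realType) (dW : measure_display)
    (W : measurableType dW) (Pr : probability W R) (d : measure_display)
    (T : measurableType d) (n : nat) (X : 'I_n -> {RV Pr >-> T})
    (I : finType) (B : I -> set T) (y : {ffun 'I_n -> {ffun I -> bool}}) :
  sample_pattern X B @^-1` [set y] =
  \bigcap_(k in [set` [set: 'I_n]%SET]) (X k @^-1` (pattern B @^-1` [set y k])).
Proof.
apply/seteqP; split=> w /=.
  by move=> <- k _ /=; rewrite ffunE.
by move=> h; apply/ffunP => k; rewrite ffunE; apply: h => /=; rewrite finset.in_setT.
Qed.

Lemma measurable_sample_pattern (R : realType) (dW : measure_display)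
    (W : measurableType dW) (Pr : probability W R) (d : measure_display)
    (T : measurableType d) (n : nat) (X : 'I_n -> {RV Pr >-> T})
    (I : finType) (B : I -> set T) (y : {ffun 'I_n -> {ffun I -> bool}}) :
  (forall i, measurable (B i)) -> measurable (sample_pattern X B @^-1` [set y]).
Proof.
move=> mB; rewrite sample_patternE.
apply: fin_bigcap_measurable; first exact: finite_finset.
by move=> k _; apply: measurable_funPTI; exact: measurable_pattern.
Qed.

Lemma expectation_sample_pattern (R : realType) (dW : measure_display)
    (W : measurableType dW) (Pr : probability W R) (d : measure_display)
    (T : measurableType d) (P : probability T R) (n : nat)
    (X : 'I_n -> {RV Pr >-> T}) (I : finType) (B : I -> set T)
    (F : {ffun 'I_n -> {ffun I -> bool}} -> R) :
  iid_with_law P X -> (forall i, measurable (B i)) -> (forall y, 0 <= F y) ->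
  (\int[Pr]_w (F (sample_pattern X B w))%:E =
    (Eprod (fun=> pattern_pmf P B) F)%:E)%E.
Proof.
move=> [indX lawX] mB F0; rewrite integral_comp_finType//; last first.
  by move=> y; exact: measurable_sample_pattern.
congr (_%:E); apply: eq_bigr => y _; congr (_ * _).
rewrite sample_patternE (indX [set: 'I_n]%SET (fun k => pattern B @^-1` [set y k])); last first.
  by move=> k; exact: measurable_pattern.
rewrite -[RHS]/(fine (\prod_k pattern_pmf P B (y k))%:E).
rewrite -prodEFin; congr fine; apply: eq_big => [k|k _]; first by rewrite finset.in_setT.
by rewrite fineK ?fin_num_measure//;
  [exact: lawX (measurable_pattern _ mB)|exact: measurable_pattern].
Qed.

(** Measurability and sign travel with the bound so that such bounds can be added. The supremum of
    the process is dominated pointwise by functions of this kind, without being shown measurable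
    itself. *)
Definition mean_le (R : realType) (d : measure_display) (W : measurableType d)
    (mu : {measure set W -> \bar R}) (f : W -> R) (b : R) : Prop :=
  [/\ measurable_fun setT f, forall w, 0 <= f w &
     (\int[mu]_w (f w)%:E <= b%:E)%E].

Lemma mean_leD (R : realType) (d : measure_display) (W : measurableType d)
    (mu : {measure set W -> \bar R}) (f g : W -> R) (a b : R) :
  mean_le mu f a -> mean_le mu g b -> mean_le mu (fun w => f w + g w) (a + b).
Proof.
move=> [mf f0 fa] [mg g0 gb]; split.
- exact: measurable_funD.
- by move=> w; rewrite addr_ge0.
- under eq_integral do rewrite EFinD.
  rewrite ge0_integralD// ?EFinD ?leeD//; first by move=> w _; rewrite lee_fin.
  + exact/measurable_EFinP.
  + by move=> w _; rewrite lee_fin.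
  + exact/measurable_EFinP.
Qed.

Lemma mean_le_cst (R : realType) (d : measure_display) (W : measurableType d)
    (Pr : probability W R) (a : R) : 0 <= a -> mean_le Pr (fun=> a) a.
Proof.
move=> a0; split=> //; rewrite integral_cst//.
by rewrite [X in (_ * X)%E](_ : _ = 1%E) ?mule1//; exact: probability_setT.
Qed.

Lemma mean_le_sum (R : realType) (d : measure_display) (W : measurableType d)
    (Pr : probability W R) (n : nat) (f : nat -> W -> R) (b : nat -> R) :
  (forall i, (i < n)%N -> mean_le Pr (f i) (b i)) ->
  mean_le Pr (fun w => \sum_(i < n) f i w) (\sum_(i < n) b i).
Proof.
elim: n => [_|n IH H].
  under eq_fun do rewrite big_ord0.
  by rewrite big_ord0; exact: mean_le_cst.
under eq_fun do rewrite big_ord_recr.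
rewrite big_ord_recr; apply: mean_leD; last exact: H.
by apply: IH => i ni; apply: H; exact: ltnW.
Qed.

(** * Maximal inequality and brackets *)

(** The mass of the symmetric difference, bounded by [v], is the [L_1] norm of
    [\1_(A i) - \1_(B i)], as the finite maximal inequality requires. *)
Lemma emp_process_maximal (R : realType) (dW : measure_display)
    (W : measurableType dW) (Pr : probability W R) (d : measure_display)
    (T : measurableType d) (P : probability T R) (n : nat)
    (X : 'I_n -> {RV Pr >-> T}) (I : finType) (A B : I -> set T) (v t h : R) :
  iid_with_law P X ->
  (forall i, measurable (A i)) -> (forall i, measurable (B i)) ->
  (forall i, (P (A i `\` B i) + P (B i `\` A i) <= v%:E)%E) ->
  0 < t -> t <= 4^-1 -> 1 <= h ->
  2 * #|I|%:R * expR (2 * n%:R * v * t ^+ 2) <= expR h ->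
  exists2 Phi : W -> R, mean_le Pr Phi ((Num.sqrt n%:R)^-1 * (h / t)) &
    forall i w,
      `|emp_process P X (A i) w - emp_process P X (B i) w| <= Phi w.
Proof.
move=> iid mA mB AB t0 t4 h1 hI.
(* Indexing by [I * bool] puts both sets of every pair into one family, so that a single pattern law
   governs all differences. *)
pose Q (ib : I * bool) := if ib.2 then A ib.1 else B ib.1.
have mQ ib : measurable (Q ib) by rewrite /Q; case: ib.2.
pose p := pattern_pmf P Q.
have pp : is_pmf p by exact: pattern_pmfP.
pose f i (s : {ffun I * bool -> bool}) : R := (s (i, true))%:R - (s (i, false))%:R.
have f1 i s : `|f i s| <= 1.
  by rewrite /f; case: (s _); case: (s _);
    rewrite ?subrr ?sub0r ?subr0 ?normrN ?normr0 ?normr1.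
have fv i : \sum_s p s * `|f i s| <= v.
  rewrite -lee_fin -expectation_pattern//; apply: le_trans (AB i).
  have mAB : measurable (A i `\` B i) by exact: measurableD.
  have mBA : measurable (B i `\` A i) by exact: measurableD.
  have ind D : measurable D -> P D = (\int[P]_x (\1_D x)%:E)%E.
    by move=> mD; rewrite integral_indic// setIT.
  rewrite (ind _ mAB) (ind _ mBA) -ge0_integralD//; try by
    apply/measurable_EFinP; exact: measurable_indic.
  rewrite le_eqVlt; apply/orP; left; apply/eqP; apply: eq_integral => x _.
  rewrite -EFinD; congr (_%:E); rewrite /f -!(indic_pattern R) /Q/= !indicE !in_setD.
  by case: (x \in A i); case: (x \in B i);
    rewrite /= ?subrr ?sub0r ?subr0 ?normrN ?normr0 ?normr1 ?addr0 ?add0r.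
have [Psi [Psi0 EPsi Psif]] := Eprod_maximal pp f1 fv t0 t4 h1 hI.
have s0 : 0 <= (Num.sqrt n%:R)^-1 :> R by rewrite invr_ge0 sqrtr_ge0.
exists (fun w => (Num.sqrt n%:R)^-1 * Psi (sample_pattern X Q w)).
have mPsi : measurable_fun setT (fun w => Psi (sample_pattern X Q w)).
  by apply: measurable_comp_finType => y; exact: measurable_sample_pattern.
  split.
  - by apply: measurable_funM => //; exact: measurable_cst.
  - by move=> w; rewrite mulr_ge0.
  - under eq_integral do rewrite EFinM.
    rewrite ge0_integralZl ?lee_fin//; last first.
    - by move=> w _; rewrite lee_fin.
    - exact/measurable_EFinP.
    rewrite (expectation_sample_pattern iid mQ Psi0) EFinM.
    by apply: lee_wpmul2l; rewrite lee_fin.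
move=> i w; rewrite /emp_process -mulrBr normrM (ger0_norm s0).
apply: ler_wpM2l => //; apply: le_trans (Psif (sample_pattern X Q w) i).
rewrite le_eqVlt; apply/orP; left; apply/eqP; congr `|_|.
rewrite -sumrB; apply: eq_bigr => k _; rewrite /f ffunE -!(indic_pattern R) /Q/=.
under eq_bigr do rewrite mulrBr.
by rewrite sumrB !pattern_pmf_indic//= /Q/=; ring.
Qed.

(** An indicator between [l] and [u] is 1 where [l > 0] and 0 where [u < 1]. On the difference of
    the two sets [u - l >= 1], so Markov's inequality bounds its mass by the [L_1] width. *)
Lemma bracket_cover_sets (R : realType) (d : measure_display)
    (T : measurableType d) (P : probability T R) (C : set (set T)) (eps : R)
    (m : nat) :
  bracket_cover P C eps m ->
  exists lo up : 'I_m -> set T,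
    (forall i, [/\ measurable (lo i), measurable (up i), lo i `<=` up i &
       (P (up i `\` lo i) <= eps%:E)%E]) /\
    (forall A, C A -> exists i, lo i `<=` A /\ A `<=` up i).
Proof.
move=> [l [u [lu cov]]].
exists (fun i => [set x | 0 < l i x]),
  (* The union keeps [lo i] inside [up i] even for a bracket that contains no indicator, and leaves
     the difference of the two sets unchanged. *)
  (fun i => [set x | 1 <= u i x \/ 0 < l i x]); split.
  move=> i; have [Ll Lu] := lu i; rewrite Lnorm1 => leps.
  have ml : measurable_fun setT (l i) by move/sub_Lfun_mfun : Ll; rewrite inE.
  have mu : measurable_fun setT (u i) by move/sub_Lfun_mfun : Lu; rewrite inE.
  have mlo : measurable [set x | 0 < l i x].
    rewrite (_ : [set x | _] = setT `&` l i @^-1` `]0, +oo[%classic).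
      exact: ml.
    by rewrite setTI; apply/seteqP; split => x /=; rewrite in_itv/= andbT.
  have mu1 : measurable [set x | 1 <= u i x].
    rewrite (_ : [set x | _] = setT `&` u i @^-1` `[1, +oo[%classic).
      exact: mu.
    by rewrite setTI; apply/seteqP; split => x /=; rewrite in_itv/= andbT.
  have mup : measurable [set x | 1 <= u i x \/ 0 < l i x] by exact: measurableU.
  split => //; first by move=> x; right.
  apply: le_trans (ltW leps).
  have mlu : measurable_fun setT (EFin \o (u i \- l i)).
    by apply/measurable_EFinP; exact: measurable_funB.
  have := @le_integral_abse _ _ _ P setT measurableT _ 1 mlu ltr01.
  rewrite mul1e setTI; apply: le_trans; apply: le_measure; rewrite ?inE.
  - exact: measurableD.
  - rewrite -[X in measurable X]setTI; apply: emeasurable_fun_c_infty => //.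
    exact: measurableT_comp.
  - move=> x /= [[ux|//] /negP]; rewrite -leNgt => lx.
    by rewrite lee_fin; apply: le_trans (ler_norm _); lra.
move=> A CA; have [i hi] := cov A CA; exists i; split=> x /=.
  move=> lx; apply: contrapT => Ax; have /andP[+ _] := hi x.
  by rewrite indicE memNset// leNgt lx.
by move=> Ax; left; have /andP[_] := hi x; rewrite indicE mem_set.
Qed.

Lemma bracketing_entropy_cover (R : realType) (d : measure_display)
    (T : measurableType d) (P : probability T R) (C : set (set T))
    (L alpha eps : R) :
  0 <= L -> bracketing_entropy_bound P C L alpha -> 0 < eps ->
  exists2 m : nat, m%:R <= 2 * expR (L * eps `^ (- alpha)) &
    bracket_cover P C eps m.
Proof.
move=> L0 bd eps0; have := bd eps eps0; set x := L * _ => bx.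
(* The margin 1 makes the comparison strict, so that an actual cover lies below it;
   [expR x + 1 <= 2 * expR x] because [x >= 0]. *)
have lt : (bracketing_number P C eps < (expR x + 1)%:E)%E.
  move: bx; case: (bracketing_number P C eps) => [r| |]; last by rewrite ltNyr.
    rewrite /lne lte_fin; have := expR_gt0 x; case: ifPn => [|]; first by lra.
    rewrite -ltNge lee_fin => r0 e0 lnr; have : r <= expR x.
      by rewrite -(@lnK _ r) ?posrE// ler_expR.
    by lra.
  by rewrite leye_eq.
have [_ [m mcov <-]] := ereal_inf_lt lt.
rewrite lte_fin => ltm; exists m => //.
have : 0 <= x by rewrite mulr_ge0// powR_ge0.
by have := expR_ge1Dx x; lra.
Qed.

(** The integral of a nonnegative function is the supremum over nonnegative simple functions below
    it, which is monotone whether or not the function is measurable. *)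
Lemma le_integral_nonmeasurable (R : realType) (d : measure_display)
    (W : measurableType d) (mu : {measure set W -> \bar R})
    (f g : W -> \bar R) :
  (forall w, 0 <= f w)%E -> (forall w, f w <= g w)%E ->
  (\int[mu]_w f w <= \int[mu]_w g w)%E.
Proof.
move=> f0 fg; have g0 w : (0 <= g w)%E by exact: le_trans (fg w).
rewrite !ge0_integralTE//; apply: le_ereal_sup => _ [h hf <-].
by exists h => // w; exact: le_trans (hf w) (fg w).
Qed.

Lemma emp_process0 (R : realType) (W : Type) (d : measure_display)
    (T : measurableType d) (P : probability T R) (n : nat)
    (X : 'I_n -> W -> T) (w : W) : emp_process P X set0 w = 0.
Proof.
rewrite /emp_process big1 ?mulr0// => i _.
by rewrite indic0 measure0 subrr.
Qed.

(** The count of [A] minus that of [lo] lies between 0 and the count of [up] minus that of [lo];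
    recentring costs at most [n * e], hence [sqrt n * e] after normalisation. *)
Lemma emp_process_sandwich (R : realType) (W : Type) (d : measure_display)
    (T : measurableType d) (P : probability T R) (n : nat)
    (X : 'I_n -> W -> T) (A lo up : set T) (e : R) (w : W) :
  (0 < n)%N -> measurable A -> measurable lo -> measurable up ->
  lo `<=` A -> A `<=` up -> (P (up `\` lo) <= e%:E)%E ->
  `|emp_process P X A w - emp_process P X lo w| <=
  `|emp_process P X up w - emp_process P X lo w| + Num.sqrt n%:R * e.
Proof.
move=> n0 mA mlo mup loA Aup Pe.
have sn : 0 < Num.sqrt n%:R :> R by rewrite sqrtr_gt0 ltr0n.
have fe (B D : set T) : measurable B -> measurable D -> B `<=` D -> fine (P B) <= fine (P D).
  move=> mB mD BD; apply: fine_le; rewrite ?fin_num_measure//.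
  by apply: le_measure; rewrite ?inE.
have {Pe} Pe : fine (P up) - fine (P lo) <= e.
  have loup : lo `<=` up by exact: subset_trans Aup.
  rewrite -lee_fin EFinB !fineK ?fin_num_measure//; apply: le_trans Pe.
  rewrite measureD//; last by rewrite -ge0_fin_numE ?fin_num_measure.
  by rewrite setIidr.
have Plo := fe _ _ mlo mA loA; have Pup := fe _ _ mA mup Aup.
pose c : R := (Num.sqrt n%:R)^-1.
have c0 : 0 <= c by rewrite invr_ge0 ltW.
have ind (B D : set T) x : B `<=` D -> \1_B x <= \1_D x :> R.
  by move=> BD; rewrite !indicE; case: (boolP (x \in B)) => // /set_mem/BD/mem_set ->.
have snE : Num.sqrt n%:R = c * n%:R :> R.
  by rewrite -[n%:R in RHS](@sqr_sqrtr R) ?ler0n// expr2 mulrA mulVf ?mul1r// gt_eqF.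
have diffE (B D : set T) : emp_process P X B w - emp_process P X D w =
    c * (\sum_(i < n) (\1_B (X i w) - \1_D (X i w)) - n%:R * (fine (P B) - fine (P D))).
  rewrite /emp_process -mulrBr -/c; congr (_ * _).
  transitivity (\sum_(i < n) ((\1_B (X i w) - \1_D (X i w)) -
      (fine (P B) - fine (P D)))).
    by rewrite -sumrB; apply: eq_bigr => i _; ring.
  by rewrite sumrB sumr_const card_ord -[_ *+ n]mulr_natl.
rewrite !diffE snE -mulrA.
set sA := \sum_(_ < _) _; set sU := \sum_(_ < _) _.
have sA0 : 0 <= sA by apply: sumr_ge0 => i _; rewrite subr_ge0 ind.
have sAU : sA <= sU by apply: ler_sum => i _; rewrite lerD2r ind.
rewrite !normrM (ger0_norm c0) -mulrDr; apply: ler_wpM2l => //.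
have n0' : 0 <= n%:R :> R by [].
apply/ler_normlP; split.
  have := normr_ge0 (sU - n%:R * (fine (P up) - fine (P lo))).
  by have := ler_wpM2l n0' Pe; have := ler_wpM2l n0' Pup; lra.
have := ler_norm (sU - n%:R * (fine (P up) - fine (P lo))).
by have := ler_wpM2l n0' Pe; have := ler_wpM2l n0' Plo; lra.
Qed.

Lemma powR_half_sub (R : realType) (e alpha : R) : 0 < e ->
  e `^ ((1 - alpha) / 2) = Num.sqrt (e / e `^ alpha).
Proof.
move=> e0; rewrite -powR12_sqrt ?divr_ge0 ?powR_ge0 ?(ltW e0)//.
rewrite -{2}(powRr1 (ltW e0)) -powRB ?(gt_eqF e0) ?implybT//.
by rewrite -powRrM.
Qed.

(** The cost of one scale. The entropy is at most [n * e], that is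
    [s = sqrt (n * e * e^alpha) >= 1], so [t = 1 / (4 s)] is admissible. With [h = D / e^alpha], the
    bound [h / (t * sqrt n)] becomes [4 * D * sqrt (e / e^alpha)]: the root of variance times
    entropy. *)
Lemma emp_process_level (R : realType) (dW : measure_display)
    (W : measurableType dW) (Pr : probability W R) (d : measure_display)
    (T : measurableType d) (P : probability T R) (n : nat)
    (X : 'I_n -> {RV Pr >-> T}) (I : finType) (A B : I -> set T)
    (L alpha e : R) :
  iid_with_law P X -> (0 < n)%N ->
  (forall i, measurable (A i)) -> (forall i, measurable (B i)) ->
  0 < L -> 0 < alpha -> 0 < e -> e <= 2 -> 1 <= n%:R * (e * e `^ alpha) ->
  (forall i, (P (A i `\` B i) + P (B i `\` A i) <= (3 * e)%:E)%E) ->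
  #|I|%:R <= 4 * expR (2 * (L * e `^ (- alpha))) ->
  exists2 Phi : W -> R, mean_le Pr Phi
      (4 * (2 * L + 3 * 2 `^ alpha + 1) * e `^ ((1 - alpha) / 2)) &
    forall i w,
      `|emp_process P X (A i) w - emp_process P X (B i) w| <= Phi w.
Proof.
move=> iid n0 mA mB L0 a0 e0 e2 ne AB cI.
set a := e `^ alpha; have a_gt0 : 0 < a by exact: powR_gt0.
have nR0 : 0 < n%:R :> R by rewrite ltr0n.
have ea0 : 0 < e * a by exact: mulr_gt0.
have nea0 : 0 < n%:R * (e * a) by exact: mulr_gt0.
have s1 : 1 <= Num.sqrt (n%:R * (e * a)) by rewrite -[leLHS]sqrtr1 ler_wsqrtr.
set s := Num.sqrt (n%:R * (e * a)) in s1 *.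
have s0 : 0 < s by lra.
have s2 : s ^+ 2 = n%:R * (e * a) by rewrite sqr_sqrtr// ltW.
(* Each summand pays for one exponent: [2 * L] for the cardinality, [3 * 2^alpha] for the factor
   [8 <= expR 3] (as [a <= 2^alpha]), and 1 for the variance term [3 / (8 a)]. *)
pose D := 2 * L + 3 * 2 `^ alpha + 1.
have D0 : 0 <= D by rewrite /D !addr_ge0// mulr_ge0// ?powR_ge0// ltW.
have a2 : a <= 2 `^ alpha by apply: ge0_ler_powR; rewrite ?nnegrE// ltW.
have ia : 1 <= 2 `^ alpha / a by rewrite ler_pdivlMr// mul1r.
have ia0 : 0 < a^-1 by rewrite invr_gt0.
have t0 : 0 < (4 * s)^-1 by rewrite invr_gt0 mulr_gt0.
have t4 : (4 * s)^-1 <= 4^-1 by rewrite lef_pV2 ?posrE ?mulr_gt0//; lra.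
have h1 : 1 <= D / a by rewrite /D !mulrDl; have := mulr_gt0 L0 ia0; lra.
have hI : 2 * #|I|%:R * expR (2 * n%:R * (3 * e) * (4 * s)^-1 ^+ 2) <= expR (D / a).
  have -> : 2 * n%:R * (3 * e) * (4 * s)^-1 ^+ 2 = 3 / 8 * a^-1.
    rewrite exprVn exprMn s2; field; rewrite ?gt_eqF//.
  rewrite /D.
  apply: (@le_trans _ _ (8 * expR (2 * (L * e `^ (- alpha))) * expR (3 / 8 * a^-1))).
    by apply: ler_wpM2r; [exact: expR_ge0|lra].
  have e8 : 8 <= expR 3 :> R.
    rewrite (_ : 3 = 3%:R * 1)// ?expRM_natl; last by ring.
    have : 2 <= expR 1 :> R by have := expR_ge1Dx (1 : R); lra.
    by move=> ?; rewrite (_ : 8 = 2 ^+ 3); [apply: lerXn2r; rewrite ?nnegrE ?expR_ge0|ring].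
  apply: (@le_trans _ _ (expR 3 * expR (2 * (L * e `^ (- alpha))) * expR (3 / 8 * a^-1))).
    by rewrite !ler_wpM2r ?expR_ge0.
  rewrite -!expRD ler_expR powRN -/a.
  by have := ia; rewrite !mulrDl; lra.
have [Phi [mPhi Phi0 EPhi] bPhi] := emp_process_maximal iid mA mB AB t0 t4 h1 hI.
exists Phi => //; split => //; apply: le_trans EPhi _; rewrite lee_fin -/D.
rewrite powR_half_sub// -/a invrK.
have -> : s = Num.sqrt n%:R * (Num.sqrt (e / a) * a).
  rewrite /s sqrtrM ?ler0n//; congr (_ * _).
  rewrite -{3}(@ger0_norm _ a) ?(ltW a_gt0)// -sqrtr_sqr -sqrtrM ?divr_ge0 ?ltW//.
  by congr Num.sqrt; field; rewrite gt_eqF.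
rewrite le_eqVlt; apply/orP; left; apply/eqP; field.
by rewrite !gt_eqF// sqrtr_gt0.
Qed.

(** * Chaining *)

Lemma sup_emp_process_le (R : realType) (W : Type) (d : measure_display)
    (T : measurableType d) (P : probability T R) (n : nat)
    (X : 'I_n -> W -> T) (C : set (set T)) (w : W) (b : R) :
  0 <= b -> (forall A, C A -> `|emp_process P X A w| <= b) ->
  sup_emp_process P X C w <= b.
Proof.
move=> b0 Cb; rewrite /sup_emp_process.
have [->|C0] := eqVneq C set0; first by rewrite image_set0 sup0.
apply: ge_sup; last by move=> _ [A CA <-]; exact: Cb.
by have /set0P[A CA] := C0; exists `|emp_process P X A w|, A.
Qed.

Lemma emp_process_bounded (R : realType) (W : Type) (d : measure_display)
    (T : measurableType d) (P : probability T R) (n : nat)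
    (X : 'I_n -> W -> T) (A : set T) (w : W) :
  `|emp_process P X A w| <= (Num.sqrt n%:R)^-1 * \sum_(i < n) (1 + `|fine (P A)|).
Proof.
rewrite normrM ger0_norm ?invr_ge0 ?sqrtr_ge0//.
apply: ler_wpM2l; rewrite ?invr_ge0 ?sqrtr_ge0//.
apply: le_trans (ler_norm_sum _ _ _) _; apply: ler_sum => i _.
apply: le_trans (ler_normB _ _) _; rewrite lerD2r indicE.
by case: (_ \in _); rewrite ?normr1 ?normr0.
Qed.

Lemma sup_emp_process_ge (R : realType) (W : Type) (d : measure_display)
    (T : measurableType d) (P : probability T R) (n : nat)
    (X : 'I_n -> W -> T) (C : set (set T)) (w : W) (A : set T) :
  (forall B, C B -> measurable B) -> C A ->
  `|emp_process P X A w| <= sup_emp_process P X C w.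
Proof.
move=> mC CA; apply: ub_le_sup; last by exists A.
exists ((Num.sqrt n%:R)^-1 * \sum_(i < n) 2) => _ [B CB <-].
apply: le_trans (emp_process_bounded _ _ _ _) _.
apply: ler_wpM2l; rewrite ?invr_ge0 ?sqrtr_ge0//; apply: ler_sum => i _.
rewrite ger0_norm ?fine_ge0//.
have : fine (P B) <= 1; last by lra.
rewrite -lee_fin fineK ?fin_num_measure//; [exact: probability_le1 (mC _ CB)|exact: mC].
Qed.

Lemma sup_emp_process_ge0 (R : realType) (W : Type) (d : measure_display)
    (T : measurableType d) (P : probability T R) (n : nat)
    (X : 'I_n -> W -> T) (C : set (set T)) (w : W) :
  (forall B, C B -> measurable B) -> 0 <= sup_emp_process P X C w.
Proof.
move=> mC; have [->|/set0P[A CA]] := eqVneq C set0.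
  by rewrite /sup_emp_process image_set0 sup0.
exact: le_trans (normr_ge0 _) (sup_emp_process_ge P X w mC CA).
Qed.

Lemma bracket_family (R : realType) (d : measure_display)
    (T : measurableType d) (P : probability T R) (C : set (set T))
    (L alpha : R) (e : nat -> R) :
  0 <= L -> bracketing_entropy_bound P C L alpha -> (forall j, 0 < e j) ->
  exists (m : nat -> nat) (lo up : forall j, 'I_(m j) -> set T),
    [/\ forall j, (m j)%:R <= 2 * expR (L * e j `^ (- alpha)),
        forall j i, [/\ measurable (lo j i), measurable (up j i),
          lo j i `<=` up j i & (P (up j i `\` lo j i) <= (e j)%:E)%E] &
        forall j A, C A -> exists i, lo j i `<=` A /\ A `<=` up j i].
Proof.
move=> L0 bd e0.
(* The type of the brackets depends on their number, so both are chosen together as a dependent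
   pair. *)
have /choice[z zP] : forall j, exists z : {m : nat & (('I_m -> set T) * ('I_m -> set T))%type},
    [/\ (tag z)%:R <= 2 * expR (L * e j `^ (- alpha)),
        forall i, [/\ measurable ((tagged z).1 i), measurable ((tagged z).2 i),
          (tagged z).1 i `<=` (tagged z).2 i &
          (P ((tagged z).2 i `\` (tagged z).1 i) <= (e j)%:E)%E] &
        forall A, C A -> exists i, (tagged z).1 i `<=` A /\ A `<=` (tagged z).2 i].
  move=> j; have [m mle cov] := bracketing_entropy_cover L0 bd (e0 j).
  have [lo [up [H cv]]] := bracket_cover_sets cov.
  by exists (existT (fun m => (('I_m -> set T) * ('I_m -> set T))%type) m (lo, up)).
exists (fun j => tag (z j)), (fun j => (tagged (z j)).1), (fun j => (tagged (z j)).2).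
by split=> j; have [] := zP j.
Qed.

(** With [e j = g * 2^j], the value at [A] is split into the step from [A] to its lower set at scale
    [g], with bias [sqrt n * g], the links between lower sets of consecutive scales, and the lower
    set at the coarsest scale. *)
Lemma chaining_bound (R : realType) (dW : measure_display)
    (W : measurableType dW) (Pr : probability W R) (d : measure_display)
    (T : measurableType d) (P : probability T R) (n J : nat)
    (X : 'I_n -> {RV Pr >-> T}) (C : set (set T)) (L alpha g s2 : R) :
  iid_with_law P X -> (0 < n)%N -> (forall A, C A -> measurable A) ->
  0 < L -> 0 < alpha -> 0 < g -> 1 <= n%:R * (g * g `^ alpha) ->
  s2 <= g * 2 ^+ J -> g * 2 ^+ J <= 2 ->
  bracketing_entropy_bound P C L alpha ->
  (\int[Pr]_w (sup_emp_process P X (subclass P C s2) w)%:E <=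
    (4 * (2 * L + 3 * 2 `^ alpha + 1) *
      (\sum_(j < J) (g * 2 ^+ j) `^ ((1 - alpha) / 2) +
       ((g * 2 ^+ J) `^ ((1 - alpha) / 2) + g `^ ((1 - alpha) / 2))) +
     Num.sqrt n%:R * g)%:E)%E.
Proof.
move=> iid n0 mC L0 a0 g0 ng s2J J2 bd.
set D := 4 * _; pose e j : R := g * 2 ^+ j.
have e_gt0 j : 0 < e j by rewrite mulr_gt0// exprn_gt0.
have e_mono i j : (i <= j)%N -> e i <= e j.
  by move=> ij; rewrite ler_wpM2l ?(ltW g0)// ler_eXn2l// ltr1n.
have g_le j : g <= e j by rewrite -[g in leLHS]mulr1 -[1 in leLHS](expr0 2) e_mono.
have e2 j : (j <= J)%N -> e j <= 2 by move=> jJ; apply: le_trans J2; exact: e_mono.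
have ne j : 1 <= n%:R * (e j * e j `^ alpha).
  apply: le_trans ng _; rewrite ler_wpM2l//; apply: ler_pM; rewrite ?powR_ge0 ?(ltW g0)//.
  by apply: ge0_ler_powR; rewrite ?nnegrE ?g_le ?(ltW a0) ?(ltW g0) ?(ltW (e_gt0 j)).
have [m [lo [up [mle lu cov]]]] := bracket_family (ltW L0) bd e_gt0.
have mlo j i : measurable (lo j i) by have [] := lu j i.
have mup j i : measurable (up j i) by have [] := lu j i.
have lou j i : lo j i `<=` up j i by have [] := lu j i.
have Plu j i : (P (up j i `\` lo j i) <= (e j)%:E)%E by have [] := lu j i.
have exp1 j : 1 <= expR (L * e j `^ (- alpha)).
  have : 0 <= L * e j `^ (- alpha) by rewrite mulr_ge0 ?powR_ge0// ltW.
  by have := expR_ge1Dx (L * e j `^ (- alpha)); lra.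
have exp2 j : expR (2 * (L * e j `^ (- alpha))) = expR (L * e j `^ (- alpha)) ^+ 2.
  by rewrite -expRM_natl.
have m1 j : #|'I_(m j)|%:R <= 4 * expR (2 * (L * e j `^ (- alpha))).
  by rewrite card_ord exp2; have := mle j; have := exp1 j; nra.
(* Intersecting each lower set with the upper set of the other scale makes the difference small for
   every pair [(i, i')]; for brackets of a common [A] the intersections change nothing. From [J] on
   nothing is asserted, so that [choice] yields a total sequence. *)
have mid j : exists Phi : W -> R, (j < J)%N ->
    mean_le Pr Phi (D * e j `^ ((1 - alpha) / 2)) /\
    forall i i' w, `|emp_process P X (lo j i `&` up j.+1 i') w -
      emp_process P X (lo j.+1 i' `&` up j i) w| <= Phi w.
  have [jJ|] := boolP (j < J)%N; last by exists (fun=> 0).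
  have [|||i||Phi mPhi bPhi] := @emp_process_level _ _ _ _ _ _ P n X ('I_(m j) * 'I_(m j.+1))%type
      (fun i => lo j i.1 `&` up j.+1 i.2) (fun i => lo j.+1 i.2 `&` up j i.1)
      L alpha (e j) iid n0 _ _ L0 a0 (e_gt0 j) _ (ne j).
  - by move=> i; exact: measurableI.
  - by move=> i; exact: measurableI.
  - exact/e2/ltnW.
  - rewrite (_ : 3 * e j = e j.+1 + e j); last by rewrite /e exprS; ring.
    rewrite EFinD; apply: leeD.
      apply: le_trans (Plu j.+1 i.2); apply: le_measure; rewrite ?inE.
      + by apply: measurableD; exact: measurableI.
      + exact: measurableD.
      + move=> x /= [[lx ux] h]; split=> // lx'; apply: h; split=> //.
        exact: lou.
    apply: le_trans (Plu j i.1); apply: le_measure; rewrite ?inE.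
    + by apply: measurableD; exact: measurableI.
    + exact: measurableD.
    + move=> x /= [[lx ux] h]; split=> // lx'; apply: h; split=> //.
      exact: lou.
  - rewrite card_prod !card_ord natrM exp2.
    have : expR (L * e j.+1 `^ (- alpha)) <= expR (L * e j `^ (- alpha)).
      rewrite ler_expR ler_wpM2l ?(ltW L0)// !powRN lef_pV2 ?posrE ?powR_gt0//.
      by apply: ge0_ler_powR; rewrite ?nnegrE ?(ltW a0) ?(ltW (e_gt0 _))//; exact: e_mono.
    have := mle j; have := mle j.+1; have := exp1 j.
    set x := expR _; set y := expR _ => x1 my mx yx.
    have -> : 4 * x ^+ 2 = (2 * x) * (2 * x) by ring.
    by apply: ler_pM => //; lra.
  by exists Phi => _; split=> // i i' w; exact: (bPhi (i, i') w).
have [Phi PhiP] := choice mid.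
(* A lower set heavier than [e J] lies inside no member of the subclass and is replaced by the empty
   set. Comparing with the empty set bounds the process itself. *)
have [|||i||Top mTop bTop] := @emp_process_level _ _ _ _ _ _ P n X 'I_(m J)
    (fun i => if (P (lo J i) <= (e J)%:E)%E then lo J i else set0) (fun=> set0)
    L alpha (e J) iid n0 _ _ L0 a0 (e_gt0 J) _ (ne J).
- by move=> i; case: ifP.
- by [].
- exact: e2.
- rewrite setD0 set0D measure0 adde0.
  have : ((e J)%:E <= (3 * e J)%:E)%E by rewrite lee_fin; have := e_gt0 J; lra.
  by apply: le_trans; case: ifP => // _; rewrite measure0 lee_fin ltW.
- exact: m1.
have [|||i||Bot mBot bBot] := @emp_process_level _ _ _ _ _ _ P n X 'I_(m 0%N)
    (up 0%N) (lo 0%N) L alpha (e 0%N) iid n0 _ _ L0 a0 (e_gt0 0%N) _ (ne 0%N).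
- by [].
- by [].
- exact: e2.
- rewrite [X in (_ + P X)%E](_ : _ = set0) ?measure0 ?adde0; last first.
    by apply/seteqP; split=> x //= [] /lou.
  by apply: le_trans (Plu 0%N i) _; rewrite lee_fin; have := e_gt0 0%N; lra.
- exact: m1.
have e0g : e 0%N = g by rewrite /e expr0 mulr1.
rewrite e0g in mBot.
have mtot := mean_leD (mean_leD (mean_le_sum (fun j jJ => (PhiP j jJ).1)) (mean_leD mTop mBot))
  (mean_le_cst Pr (mulr_ge0 (sqrtr_ge0 n%:R) (ltW g0))).
have [_ tot0 Etot] := mtot.
rewrite !mulrDr mulr_sumr; apply: le_trans Etot.
apply: le_integral_nonmeasurable => w; rewrite lee_fin.
  by apply: sup_emp_process_ge0 => B [/mC].
apply: sup_emp_process_le => // A [CA PA].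
pose pi j := sval (cid (cov j A CA)).
have piP j : lo j (pi j) `<=` A /\ A `<=` up j (pi j) by exact: svalP (cid (cov j A CA)).
pose G B := emp_process P X B w.
have tele k : (k <= J)%N ->
    `|G A| <= `|G A - G (lo 0%N (pi 0%N))| + \sum_(j < k) Phi j w + `|G (lo k (pi k))|.
  elim: k => [_|k IH kJ].
    rewrite big_ord0 addr0; apply: le_trans (ler_normD _ _).
    by rewrite subrK.
  apply: le_trans (IH (ltnW kJ)) _; rewrite big_ord_recr/= -!addrA !lerD2l.
  have [_ /(_ (pi k) (pi k.+1) w)] := PhiP k kJ.
  rewrite !setIidl; last 2 first.
  - exact: subset_trans (piP k.+1).1 (piP k).2.
  - exact: subset_trans (piP k).1 (piP k.+1).2.
  move=> h; apply: le_trans (lerD h (lexx _)); apply: le_trans (ler_normD _ _).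
  by rewrite subrK.
apply: le_trans (tele J (leqnn J)) _.
have bot := emp_process_sandwich X w n0 (mC _ CA) (mlo 0%N (pi 0%N))
  (mup 0%N (pi 0%N)) (piP 0%N).1 (piP 0%N).2 (Plu 0%N (pi 0%N)).
have top := bTop (pi J) w.
move: top; rewrite ifT; last first.
  apply: le_trans (_ : P A <= _)%E.
    by apply: le_measure; rewrite ?inE//; [exact: mC|exact: (piP J).1].
  by apply: le_trans PA _; rewrite lee_fin.
rewrite emp_process0 subr0 -/(G _) => top.
by have := bBot (pi 0%N) w; move: bot; rewrite e0g -!/(G _); lra.
Qed.

(** * Summation over scales and the upper bound *)

Lemma powR_geometric (R : realType) (g b : R) (j : nat) : 0 <= g ->
  (g * 2 ^+ j) `^ b = g `^ b * (2 `^ b) ^+ j.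
Proof.
move=> g0; rewrite powRM ?exprn_ge0//; congr (_ * _).
by rewrite -!powR_mulrn ?powR_ge0// powRAC.
Qed.

(** The ratio [r = 2^b] differs from 1 because [b != 0]; this is where [alpha != 1] enters. For
    either sign of [r - 1], [|r - 1| * S = |r^J - 1|] is at most the larger of [r^J] and 1. The two
    end terms add 2 to the constant. *)
Lemma dyadic_sum_le (R : realType) (b : R) : b != 0 ->
  exists2 K : R, 0 < K & forall (g : R) (J : nat), 0 < g ->
    \sum_(j < J) (g * 2 ^+ j) `^ b + ((g * 2 ^+ J) `^ b + g `^ b) <=
    K * Num.max ((g * 2 ^+ J) `^ b) (g `^ b).
Proof.
move=> b0; set r : R := 2 `^ b.
have r0 : 0 < r by exact: powR_gt0.
have r1 : r != 1 by rewrite /r powR_eq1 !negb_or b0 -leNgt ler0n andbT gt_eqF ?ltr1n.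
have d0 : 0 < `|r - 1| by rewrite normr_gt0 subr_eq0.
exists (`|r - 1|^-1 + 2) => [|g J g0]; first by rewrite addr_gt0// invr_gt0.
rewrite powR_geometric ?(ltW g0)// -/r.
under eq_bigr do rewrite powR_geometric ?(ltW g0)// -/r.
rewrite -mulr_sumr; set S := \sum_(_ < _) _.
have gb0 : 0 <= g `^ b by exact: powR_ge0.
rewrite -[X in Num.max _ X]mulr1 -maxr_pMr//.
set M := Num.max (r ^+ J) 1.
have M1 : 1 <= M by rewrite le_max lexx orbT.
have MJ : r ^+ J <= M by rewrite le_max lexx.
have rJ : 0 < r ^+ J by exact: exprn_gt0.
suff : S <= `|r - 1|^-1 * M.
  move=> SM; have := ler_wpM2l gb0 SM.
  by have := ler_wpM2l gb0 M1; have := ler_wpM2l gb0 MJ; lra.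
rewrite mulrC ler_pdivlMr//.
have SE : (r - 1) * S = r ^+ J - 1 by rewrite subrX1.
have S0 : 0 <= S by apply: sumr_ge0 => j _; rewrite exprn_ge0// ltW.
by case: (ger0P (r - 1)) => h; lra.
Qed.

(** No probability exceeds 1. The cap keeps the coarsest scale of the chain at most 2 when [sigma]
    is large. *)
Lemma subclass_min1 (R : realType) (d : measure_display)
    (T : measurableType d) (P : probability T R) (C : set (set T)) (s2 : R) :
  (forall A, C A -> measurable A) ->
  subclass P C s2 = subclass P C (Num.min s2 1).
Proof.
move=> mC; apply/seteqP; split=> A [CA PA]; split=> //; rewrite EFin_min le_min in PA *.
  by rewrite PA probability_le1//; exact: mC.
by case/andP: PA.
Qed.

(* The resolution g = n^(-1/(alpha+1)) balances the entropy g^(-alpha) against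
   the sample size: n g = g^(-alpha). *)
Lemma resolution_powR (R : realType) (alpha : R) (n : nat) :
  0 < alpha -> (0 < n)%N ->
  let g : R := n%:R `^ (- (alpha + 1)^-1) in
  [/\ 0 < g, g <= 1, n%:R * (g * g `^ alpha) = 1,
      g `^ ((1 - alpha) / 2) = n%:R `^ ((alpha - 1) / (2 * (alpha + 1))) &
      Num.sqrt n%:R * g = g `^ ((1 - alpha) / 2)].
Proof.
move=> a0 n0 g; have nR0 : 0 < n%:R :> R by rewrite ltr0n.
have a1 : alpha + 1 != 0 by rewrite gt_eqF// addr_gt0.
have nn : n%:R != 0 :> R by rewrite gt_eqF.
have gb : g `^ ((1 - alpha) / 2) = n%:R `^ ((alpha - 1) / (2 * (alpha + 1))).
  by rewrite /g -powRrM; congr (_ `^ _); field.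
split=> //.
- exact: powR_gt0.
- rewrite /g powRN invf_le1 ?powR_gt0//.
  have {1}<- : 1 `^ (alpha + 1)^-1 = 1 :> R by rewrite powR1.
  apply: ge0_ler_powR.
  + by rewrite invr_ge0 addr_ge0// ltW.
  + by rewrite nnegrE.
  + by rewrite nnegrE.
  + by rewrite ler1n.
- rewrite /g -powRrM -powRD ?nn ?implybT// -[X in X * _]powRr1// -powRD ?nn ?implybT//.
  by rewrite (_ : _ + _ = 0) ?powRr0//; field.
- rewrite gb -powR12_sqrt// -powRD ?nn ?implybT//.
  by congr (_ `^ _); field.
Qed.

Lemma upper_bound (R : realType) (alpha L : R) :
  0 < alpha -> alpha != 1 -> 0 < L ->
  exists2 K : R, 0 < K &
    forall (d : measure_display) (T : measurableType d) (P : probability T R)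
      (dW : measure_display) (W : measurableType dW) (Pr : probability W R)
      (n : nat) (X : 'I_n -> {RV Pr >-> T}) (C : set (set T)) (sigma : R),
    (0 < n)%N -> iid_with_law P X -> (forall A, C A -> measurable A) ->
    0 < sigma -> bracketing_entropy_bound P C L alpha ->
    ('E_Pr[sup_emp_process P X (subclass P C (sigma ^+ 2))]
       <= (K * rate alpha sigma n)%:E)%E.
Proof.
move=> a0 a1 L0; pose b := (1 - alpha) / 2.
have b0 : b != 0 by rewrite mulf_neq0 ?invr_eq0// subr_eq0 eq_sym.
have [K1 K10 HK] := dyadic_sum_le b0.
set D := 4 * (2 * L + 3 * 2 `^ alpha + 1).
have D0 : 0 < D by rewrite /D; have := powR_ge0 2 alpha; nra.
have b2 : 0 <= 2 `^ b by exact: powR_ge0.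
exists (D * K1 * (1 + 2 `^ b) + 1).
  by rewrite addr_gt0// (mulr_gt0 (mulr_gt0 D0 K10))//; lra.
move=> d T P dW W Pr n X C sigma n0 iid mC s0 bd.
have [] := @resolution_powR R alpha n a0 n0; rewrite -/b.
set g := n%:R `^ _ => g0 g1 ng gb sg.
have : exists J, Num.min (sigma ^+ 2) 1 <= g * 2 ^+ J.
  exists (Num.bound g^-1); rewrite ge_min; apply/orP; right.
  rewrite mulrC -ler_pdivrMr// div1r.
  have ig : 0 <= g^-1 by rewrite invr_ge0 ltW.
  apply: le_trans (ltW (archi_boundP ig)) _.
  by rewrite -natrX ler_nat ltnW// ltn_expl.
case/ex_minnP => J HJ minJ.
(* By minimality of [J] the coarsest scale overshoots [min (sigma^2, 1)] by a factor at most 2,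
   unless [g] alone already reaches it. *)
have J0 : (J = 0)%N \/ g * 2 ^+ J <= 2 * Num.min (sigma ^+ 2) 1.
  case: J HJ minJ => [|J] HJ minJ; [by left|right].
  have : g * 2 ^+ J < Num.min (sigma ^+ 2) 1.
    by rewrite ltNge; apply/negP => /minJ; rewrite ltnn.
  by rewrite [2 ^+ J.+1]exprS; lra.
have J2 : g * 2 ^+ J <= 2.
  case: J0 => [->|]; first by rewrite expr0; lra.
  by move/le_trans; apply; rewrite -[leRHS]mulr1 ler_pM2l// ge_min lexx orbT.
rewrite unlock subclass_min1//.
apply: le_trans (chaining_bound iid n0 mC L0 a0 g0 _ HJ J2 bd) _; first by rewrite ng.
rewrite lee_fin -/b -/D sg.
have gr : g `^ b <= rate alpha sigma n by rewrite gb /rate le_max lexx orbT.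
have r0 : 0 <= rate alpha sigma n by apply: le_trans gr; exact: powR_ge0.
suff : Num.max ((g * 2 ^+ J) `^ b) (g `^ b) <= (1 + 2 `^ b) * rate alpha sigma n.
  move=> h; have := HK g J g0; move/(ler_wpM2l (ltW D0)) => h1.
  have := ler_wpM2l (ltW (mulr_gt0 D0 K10)) h; lra.
have br0 := mulr_ge0 b2 r0.
rewrite ge_max; apply/andP; split; last by lra.
have gJ0 : 0 < g * 2 ^+ J by rewrite mulr_gt0// exprn_gt0.
case: J0 => [->|gJ]; first by rewrite expr0 mulr1; lra.
(* For [b >= 0] the coarse end is comparable with [sigma^(1 - alpha)], the factor 2 costing [2^b];
   for [b < 0] the fine end [g^b] dominates. *)
have [bpos|bneg] := leP 0 b.
  have : (g * 2 ^+ J) `^ b <= (2 * sigma ^+ 2) `^ b.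
    apply: ge0_ler_powR; rewrite ?nnegrE ?(ltW gJ0)//.
      by rewrite mulr_ge0// sqr_ge0.
    by apply: le_trans gJ _; rewrite ler_pM2l// ge_min lexx.
  rewrite [X in _ <= X -> _]powRM ?sqr_ge0// -(powR_mulrn 2%N (ltW s0)) -powRrM.
  rewrite (_ : 2 * b = 1 - alpha); last by rewrite /b; field.
  have : sigma `^ (1 - alpha) <= rate alpha sigma n by rewrite /rate le_max lexx.
  by move=> h; have := ler_wpM2l b2 h; lra.
apply: (@le_trans _ _ (g `^ b)); last by lra.
rewrite -[b]opprK !(powRN _ (- b)) lef_pV2 ?posrE ?(powR_gt0 _ g0) ?(powR_gt0 _ gJ0)//.
apply: ge0_ler_powR; rewrite ?nnegrE ?(ltW g0) ?(ltW gJ0)//; first by lra.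
by rewrite ler_peMr ?(ltW g0)// exprn_ege1// ler1n.
Qed.

(** * Packings and the lower bound *)

Lemma indic_Lfun1 (R : realType) (d : measure_display) (T : measurableType d)
    (P : probability T R) (A : set T) : measurable A -> \1_A \in Lfun P 1.
Proof.
by move=> mA; apply/Lfun1_integrable; apply: integrable_indic; rewrite ?fin_num_fun_lty.
Qed.

(** Greedy choice: fewer than [m] sets cannot be the centres of a cover, so some further set of the
    class lies at distance at least [eps] from all of them. *)
Lemma packing_exists (R : realType) (d : measure_display)
    (T : measurableType d) (P : probability T R) (C : set (set T)) (eps : R)
    (m : nat) :
  (forall A, C A -> measurable A) ->
  ((m%:R)%:E <= covering_number P C eps)%E ->
  exists A : nat -> set T, (forall i, (i < m)%N -> C (A i)) /\
    forall i j, (i < j < m)%N ->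
      (eps%:E <= \int[P]_x `|\1_(A j) x - \1_(A i) x|%:E)%E.
Proof.
move=> mC mcov.
suff : forall k, (k <= m)%N -> exists A : nat -> set T,
    (forall i, (i < k)%N -> C (A i)) /\
    forall i j, (i < j < k)%N ->
      (eps%:E <= \int[P]_x `|\1_(A j) x - \1_(A i) x|%:E)%E by exact.
elim=> [_|k IH km]; first by exists (fun=> set0); split=> // i j; rewrite ltn0 andbF.
have [A [CA sepA]] := IH (ltnW km).
have [B CB sepB] : exists2 B, C B & forall i : 'I_k,
    (eps%:E <= \int[P]_x `|\1_B x - \1_(A i) x|%:E)%E.
  apply: contrapT => nB.
  have : ball_cover P C eps k.
    exists (fun i : 'I_k => \1_(A i)); split=> [i|B CB].
      by apply: indic_Lfun1; apply: mC; exact: CA.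
    apply: contrapT => nbig; apply: nB; exists B => // i.
    rewrite leNgt; apply/negP => h; apply: nbig; exists i.
    by rewrite Lnorm1.
  move=> kcov; have : (covering_number P C eps <= (k%:R)%:E)%E.
    by apply: ereal_inf_lbound; exists k.
  by move/(le_trans mcov); rewrite lee_fin ler_nat leqNgt km.
exists (fun i => if (i < k)%N then A i else B); split.
  by move=> i _; case: ifPn => // ik; exact: CA.
move=> i j /andP[ij jk].
have ik : (i < k)%N by apply: leq_trans ij _.
rewrite ik; case: ifPn => [jk'|_]; last exact: (sepB (Ordinal ik)).
by apply: sepA; rewrite ij.
Qed.

(** For [1 < x] the truncation in [log_e] is inactive, since it only ever returns the value 1. *)
Lemma covering_number_ge (R : realType) (d : measure_display)
    (T : measurableType d) (P : probability T R) (C : set (set T))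
    (eps x : R) :
  1 < x -> (x%:E <= log_e (covering_number P C eps))%E ->
  ((expR x)%:E <= covering_number P C eps)%E.
Proof.
move=> x1; rewrite /log_e.
case: (covering_number P C eps) => [r| |] h; last 2 first.
- exact: leey.
- by move: h; rewrite maxeNy lne_EFin ?expR_gt0// expRK lee_fin => h; exfalso; lra.
move: h; have [re|re] := leP r (expR 1).
  by rewrite -EFin_max max_l// lne_EFin ?expR_gt0// expRK lee_fin => h; exfalso; lra.
have r0 : 0 < r by apply: lt_trans re; exact: expR_gt0.
rewrite -EFin_max max_r ?(ltW re)// lne_EFin// lee_fin => h.
by rewrite lee_fin -(@lnK _ r) ?posrE// ler_expR.
Qed.

(** The sets of a packing are the hypotheses to be tested. For indicators the squared difference
    equals the absolute one, so [L_1] separation is the separation that [Eprod_sudakov] asks for. *)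
Lemma sudakov_bound (R : realType) (dW : measure_display)
    (W : measurableType dW) (Pr : probability W R) (d : measure_display)
    (T : measurableType d) (P : probability T R) (n : nat)
    (X : 'I_n -> {RV Pr >-> T}) (C : set (set T)) (L alpha eps lam s2 : R) :
  iid_with_law P X -> (0 < n)%N -> (forall A, C A -> measurable A) ->
  0 < eps -> eps <= 8^-1 -> 4 <= L^-1 * eps `^ (- alpha) ->
  0 <= lam <= 1 -> n%:R * lam ^+ 2 * eps <= L^-1 * eps `^ (- alpha) / 4 ->
  eps <= s2 ->
  covering_entropy_lower_bound P C L alpha ->
  ((Num.sqrt n%:R * lam * eps / 128)%:E <=
    'E_Pr[sup_emp_process P X (subclass P C s2)])%E.
Proof.
move=> iid n0 mC e0 e8 x4 lam01 lamx es2 cov.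
set x := L^-1 * eps `^ (- alpha) in x4 lamx.
have mS s A : subclass P C s A -> measurable A by move=> [/mC].
have expx : ((expR x)%:E <= covering_number P (subclass P C eps) (eps / 4))%E.
  by apply: covering_number_ge; [lra|exact: cov].
pose m := Num.truncn (expR x).
have /andP[mx xm] : m%:R <= expR x < m.+1%:R by exact: truncn_itv (expR_ge0 x).
have [A [CA sepA]] : exists A : nat -> set T,
    (forall i, (i < m)%N -> subclass P C eps (A i)) /\
    forall i j, (i < j < m)%N ->
      ((eps / 4)%:E <= \int[P]_x `|\1_(A j) x - \1_(A i) x|%:E)%E.
  apply: packing_exists; first exact: mS.
  by apply: le_trans expx; rewrite lee_fin.
pose B (k : 'I_m) := A k.
have mB k : measurable (B k) by apply: mS (CA k (ltn_ord k)).
pose p := pattern_pmf P B.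
pose f (k : 'I_m) (s : {ffun 'I_m -> bool}) : R := (s k)%:R.
have pf k : \sum_s p s * f k s = fine (P (B k)) by exact: pattern_pmf_indic.
pose F (y : {ffun 'I_n -> {ffun 'I_m -> bool}}) : R :=
  \big[Num.max/0]_k `|\sum_i (f k (y i) - \sum_s p s * f k s)|.
have F0 y : 0 <= F y by exact: bigmax_ge_id.
have FE : n%:R * lam * eps / 128 <= Eprod (fun=> p) F.
  apply: (@Eprod_sudakov _ _ _ _ p f) => //.
  - exact: pattern_pmfP.
  - by move=> k s; rewrite /f; case: (s k); rewrite /= lexx ler01.
  - move=> k; rewrite pf -lee_fin fineK ?fin_num_measure//.
    exact: (CA k (ltn_ord k)).2.
  - have sq (j k : 'I_m) : (\int[P]_x `|\1_(A j) x - \1_(A k) x|%:E =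
        (\sum_s p s * (f j s - f k s) ^+ 2)%:E)%E.
      rewrite -expectation_pattern//; last by move=> s; exact: sqr_ge0.
      apply: eq_integral => t _; congr (_%:E).
      rewrite /f -!(indic_pattern R) /B !indicE.
      by case: (_ \in _); case: (_ \in _);
        rewrite ?subrr ?sub0r ?subr0 ?normrN ?normr0 ?normr1 ?sqrrN ?expr1n ?expr0n.
    move=> j k jk; rewrite -lee_fin -sq.
    have [jk'|kj'|/val_inj jk'] := ltngtP (j : nat) k.
    + by rewrite sq; under eq_bigr do rewrite -sqrrN opprB;
        rewrite -sq; apply: sepA; rewrite jk' ltn_ord.
    + by apply: sepA; rewrite kj' ltn_ord.
    + by rewrite jk' eqxx in jk.
  - by rewrite (ltW e0).
  (* With [u = expR (x / 4)], [x >= 4] gives [u >= 2], and then the integer part [m > u^4 - 1] is at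
     least [4 u]. *)
  - apply: le_trans (_ : expR (x / 4) <= _); first by rewrite ler_expR.
    have u2 : 2 <= expR (x / 4) by have := expR_ge1Dx (x / 4); lra.
    have xE : expR x = expR (x / 4) ^+ 4 by rewrite -expRM_natl; congr expR; field.
    move: xm; rewrite xE -[m.+1%:R]natr1; set u := expR (x / 4) in u2 * => xm.
    have uu : 2 * u <= u ^+ 2 by rewrite expr2; nra.
    have : 4 * u ^+ 2 <= u ^+ 2 * u ^+ 2 by apply: ler_wpM2r; [exact: sqr_ge0|lra].
    have uE : u ^+ 4 = u ^+ 2 * u ^+ 2 by ring.
    by rewrite uE in xm; lra.
  - by move=> y k; exact: (le_bigmax _ (fun k => `|\sum_i (f k (y i) - \sum_s p s * f k s)|)).
have sn : 0 < Num.sqrt n%:R :> R by rewrite sqrtr_gt0 ltr0n.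
rewrite unlock.
apply: le_trans (_ : \int[Pr]_w
  ((Num.sqrt n%:R)^-1 * F (sample_pattern X B w))%:E <= _)%E; last first.
  apply: le_integral_nonmeasurable => w; rewrite lee_fin.
    by rewrite mulr_ge0// invr_ge0 ltW.
  rewrite ler_pdivrMl//; apply: bigmax_le => [|k _].
    by rewrite mulr_ge0 ?(ltW sn)//; apply: sup_emp_process_ge0 => D; exact: mS.
  have CB : subclass P C s2 (B k).
    have [CBk PB] := CA k (ltn_ord k); split=> //.
    by apply: le_trans PB _; rewrite lee_fin.
  have := sup_emp_process_ge P X w (@mS s2) CB.
  rewrite -(ler_pM2l sn); apply: le_trans.
  rewrite /emp_process normrM ger0_norm ?invr_ge0 ?(ltW sn)// mulVKf ?gt_eqF//.
  rewrite le_eqVlt; apply/orP; left; apply/eqP; congr `|_|; apply: eq_bigr => i _.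
  by rewrite pf /f ffunE -(indic_pattern R).
rewrite (@expectation_sample_pattern _ _ _ _ _ _ P _ X _ B
  (fun y => (Num.sqrt n%:R)^-1 * F y))//; last first.
  by move=> y; rewrite mulr_ge0// invr_ge0 ltW.
rewrite EprodZ lee_fin ler_pdivlMl//; apply: le_trans FE.
rewrite -[n%:R in leRHS](@sqr_sqrtr R) ?ler0n// expr2.
by rewrite !mulrA.
Qed.

(** The tilt is as large as the entropy permits, but at most 1. If the entropy binds,
    [sqrt n * lam * eps] equals [sqrt (eps / eps^alpha) / sqrt (4 L)]; if the cap binds, it is at
    least [sqrt kappa * sqrt (eps / eps^alpha)]. *)
Lemma sudakov_power_bound (R : realType) (dW : measure_display)
    (W : measurableType dW) (Pr : probability W R) (d : measure_display)
    (T : measurableType d) (P : probability T R) (n : nat)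
    (X : 'I_n -> {RV Pr >-> T}) (C : set (set T)) (L alpha kappa eps s2 : R) :
  iid_with_law P X -> (0 < n)%N -> (forall A, C A -> measurable A) ->
  0 < L -> 0 < eps -> eps <= 8^-1 -> 4 <= L^-1 * eps `^ (- alpha) ->
  0 <= kappa -> kappa <= n%:R * (eps * eps `^ alpha) -> eps <= s2 ->
  covering_entropy_lower_bound P C L alpha ->
  ((Num.min (Num.sqrt kappa) (Num.sqrt (4 * L))^-1 / 128 *
     eps `^ ((1 - alpha) / 2))%:E <=
    'E_Pr[sup_emp_process P X (subclass P C s2)])%E.
Proof.
move=> iid n0 mC L0 e0 e8 x4 kap0 kap es2 cov.
set a := eps `^ alpha in kap *; have a_gt0 : 0 < a by exact: powR_gt0.
have nR0 : 0 < n%:R :> R by rewrite ltr0n.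
have Na : eps `^ (- alpha) = a^-1 by rewrite powRN.
pose q := Num.sqrt (L^-1 * a^-1 / (4 * (n%:R * eps))).
have q0 : 0 <= q by exact: sqrtr_ge0.
have q2 : q ^+ 2 = L^-1 * a^-1 / (4 * (n%:R * eps)).
  by rewrite sqr_sqrtr// divr_ge0 ?mulr_ge0 ?invr_ge0// ltW.
pose lam := Num.min 1 q.
have lam01 : 0 <= lam <= 1 by rewrite /lam le_min ge_min lexx ler01 q0.
have lamx : n%:R * lam ^+ 2 * eps <= L^-1 * eps `^ (- alpha) / 4.
  rewrite Na; have -> : L^-1 * a^-1 / 4 = n%:R * q ^+ 2 * eps.
    by rewrite q2; field; rewrite !gt_eqF.
  rewrite ler_pM2r// ler_pM2l// lerXn2r ?nnegrE//; first by case/andP: lam01.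
  by rewrite /lam ge_min lexx orbT.
apply: le_trans (sudakov_bound iid n0 mC e0 e8 x4 lam01 lamx es2 cov).
rewrite lee_fin powR_half_sub// -/a mulrAC ler_pM2r ?invr_gt0//.
have sea0 : 0 <= Num.sqrt (eps / a) by exact: sqrtr_ge0.
have ea0 : 0 <= eps / a by rewrite divr_ge0// ltW.
rewrite /lam; have [q1|q1] := leP 1 q.
  apply: (@le_trans _ _ (Num.sqrt kappa * Num.sqrt (eps / a))).
    by rewrite ler_wpM2r// ge_min lexx.
  rewrite mulr1 -[eps in leRHS]gtr0_norm// -sqrtr_sqr -!sqrtrM//.
  have -> : n%:R * eps ^+ 2 = n%:R * (eps * a) * (eps / a).
    by field; rewrite gt_eqF.
  by rewrite ler_wsqrtr// ler_wpM2r.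
apply: (@le_trans _ _ ((Num.sqrt (4 * L))^-1 * Num.sqrt (eps / a))).
  by rewrite ler_wpM2r// ge_min lexx orbT.
rewrite -sqrtrV ?mulr_ge0 ?(ltW L0)// -sqrtrM ?invr_ge0 ?mulr_ge0 ?(ltW L0)//.
rewrite -[eps in leRHS]gtr0_norm// -sqrtr_sqr -sqrtrM// -sqrtrM; last first.
  by rewrite mulr_ge0// divr_ge0 ?mulr_ge0 ?invr_ge0 ?ltW.
rewrite le_eqVlt; apply/orP; left; apply/eqP; congr Num.sqrt.
by field; rewrite !gt_eqF.
Qed.

Lemma lower_bound (R : realType) (alpha L c : R) :
  0 < alpha -> alpha != 1 -> 0 < L -> 0 < c ->
  exists2 k : R, 0 < k &
    forall (d : measure_display) (T : measurableType d) (P : probability T R)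
      (dW : measure_display) (W : measurableType dW) (Pr : probability W R)
      (n : nat) (X : 'I_n -> {RV Pr >-> T}) (C : set (set T)) (sigma : R),
    (0 < n)%N -> iid_with_law P X -> (forall A, C A -> measurable A) ->
    0 < sigma -> c * n%:R `^ (- (alpha + 1)^-1) <= sigma ^+ 2 ->
    (alpha < 1 -> sigma <= 1) ->
    covering_entropy_lower_bound P C L alpha ->
    ((k * rate alpha sigma n)%:E
       <= 'E_Pr[sup_emp_process P X (subclass P C (sigma ^+ 2))])%E.
Proof.
move=> a0 a1 L0 c0; pose b := (1 - alpha) / 2.
(* For [eps = delta * tau] with [tau <= 1], the three terms ensure in turn [eps <= 1/8],
   [delta * g <= sigma^2], and an entropy of at least 4. *)
pose delta := Num.min (Num.min 8^-1 c) ((4 * L) `^ (- alpha^-1)).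
have L4 : 0 < 4 * L by exact: mulr_gt0.
have d0 : 0 < delta by rewrite !lt_min c0 powR_gt0// invr_gt0 ltr0n.
have d8 : delta <= 8^-1 by rewrite !ge_min lexx.
have dc : delta <= c by rewrite !ge_min lexx orbT.
have dL : delta `^ alpha <= (4 * L)^-1.
  have <- : ((4 * L) `^ (- alpha^-1)) `^ alpha = (4 * L)^-1.
    by rewrite -powRrM mulNr mulVf ?gt_eqF// powR_inv1// ltW.
  apply: ge0_ler_powR; rewrite ?nnegrE ?powR_ge0 ?(ltW a0) ?(ltW d0)//.
  by rewrite ge_min lexx orbT.
(* The minimum bounds [n * tau * tau^alpha] from below: it is 1 for [tau = g], and at least
   [c * c^alpha] for [tau = sigma^2 >= c * g]. *)
pose kappa := delta * delta `^ alpha * Num.min 1 (c * c `^ alpha).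
have da0 : 0 < delta `^ alpha by exact: powR_gt0.
have kappa0 : 0 < kappa.
  by rewrite !mulr_gt0// lt_min ltr01 mulr_gt0// powR_gt0.
pose k0 := Num.min (Num.sqrt kappa) (Num.sqrt (4 * L))^-1 / 128.
have k00 : 0 < k0 by rewrite divr_gt0// lt_min invr_gt0 !sqrtr_gt0 kappa0 L4.
have cb0 : 0 < c `^ b by exact: powR_gt0.
have icb0 : 0 < (c `^ b)^-1 by rewrite invr_gt0.
have db0 : 0 < delta `^ b by exact: powR_gt0.
(* The rate has two ends: 1 covers the one equal to [tau^b]; the other costs [(c^b)^-1] if
   [tau = sigma^2] and [c^b] if [tau = g]. *)
pose kc := 1 + c `^ b + (c `^ b)^-1.
have kc0 : 0 < kc by rewrite /kc; lra.
exists (k0 * delta `^ b / kc); first by rewrite divr_gt0// mulr_gt0.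
move=> d T P dW W Pr n X C sigma n0 iid mC s0 cs s1 cov.
have [] := @resolution_powR R alpha n a0 n0; rewrite -/b.
move: cs; set g := n%:R `^ _ => cs g0 g1 ng gb sg.
have nR0 : 0 < n%:R :> R by rewrite ltr0n.
have s20 : 0 < sigma ^+ 2 by exact: exprn_gt0.
have sb : sigma `^ (1 - alpha) = (sigma ^+ 2) `^ b.
  rewrite -(powR_mulrn 2%N (ltW s0)) -powRrM; congr (_ `^ _).
  by rewrite /b; field.
have powmul (u v : R) r : 0 < u -> 0 < v -> (u * v) `^ r = u `^ r * v `^ r.
  by move=> u0 v0; rewrite powRM// ltW.
suff [tau [tau0 taus tau1 ntau rtau]] : exists tau : R, [/\ 0 < tau,
    delta * tau <= sigma ^+ 2, tau <= 1,
    Num.min 1 (c * c `^ alpha) <= n%:R * (tau * tau `^ alpha) &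
    rate alpha sigma n <= kc * tau `^ b].
  have e0 : 0 < delta * tau by exact: mulr_gt0.
  have ed : delta * tau <= delta by rewrite ler_piMr// ltW.
  apply: le_trans (@sudakov_power_bound _ _ _ Pr _ _ P n X C L alpha kappa
    (delta * tau) (sigma ^+ 2) iid n0 mC L0 e0 _ _ (ltW kappa0) _ taus cov).
  - rewrite lee_fin -/k0 powmul// -/b.
    rewrite (_ : _ / kc * _ = k0 * (delta `^ b * (kc^-1 * rate alpha sigma n))); last by ring.
    by rewrite ler_pM2l// ler_pM2l// ler_pdivrMl.
  - exact: le_trans d8.
  - rewrite powRN -invfM -[4 in leLHS]invrK lef_pV2 ?posrE ?invr_gt0// ?mulr_gt0 ?powR_gt0//.
    rewrite mulrC -ler_pdivlMr// -invfM; apply: le_trans dL.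
    by apply: ge0_ler_powR; rewrite ?nnegrE ?(ltW a0) ?(ltW e0) ?(ltW d0).
  - rewrite powmul//.
    have -> : n%:R * (delta * tau * (delta `^ alpha * tau `^ alpha)) =
        delta * delta `^ alpha * (n%:R * (tau * tau `^ alpha)) by ring.
    by rewrite ler_pM2l// mulr_gt0.
have gtb0 : 0 <= g `^ b by exact: powR_ge0.
have cg0 : 0 < c * g by exact: mulr_gt0.
have stb0 : 0 <= (sigma ^+ 2) `^ b by exact: powR_ge0.
have [alt|age] := ltP alpha 1.
  exists (sigma ^+ 2); split=> //.
  - by rewrite ler_piMl ?(ltW s20)//; lra.
  - by rewrite exprn_ile1 ?(ltW s0)// s1.
  - apply: le_trans (_ : n%:R * (c * g * (c * g) `^ alpha) <= _).
      rewrite powmul// [leRHS](_ : _ = c * c `^ alpha * (n%:R * (g * g `^ alpha))).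
        by rewrite ng mulr1 ge_min lexx orbT.
      by ring.
    rewrite ler_pM2l//; apply: ler_pM; rewrite ?powR_ge0 ?(ltW cg0)//.
    by apply: ge0_ler_powR; rewrite ?nnegrE ?cs ?(ltW a0) ?(ltW cg0) ?(ltW s20).
  - rewrite /rate -gb sb ge_max; apply/andP; split.
      by rewrite ler_peMl// /kc; lra.
    have b0 : 0 <= b by rewrite /b divr_ge0// subr_ge0 ltW.
    have : (c * g) `^ b <= (sigma ^+ 2) `^ b.
      by apply: ge0_ler_powR; rewrite ?nnegrE ?cs ?(ltW cg0) ?(ltW s20).
    rewrite powmul// -ler_pdivlMl// => /le_trans; apply.
    by rewrite ler_wpM2r// /kc; lra.
exists g; split=> //.
- by apply: le_trans cs; rewrite ler_pM2r.
- by rewrite ng ge_min lexx.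
- rewrite /rate -gb sb ge_max; apply/andP; split; last first.
    by rewrite ler_peMl// /kc; lra.
  apply: (@le_trans _ _ ((c * g) `^ b)); last first.
    by rewrite powmul// ler_wpM2r// /kc; lra.
  rewrite -[b]opprK !(powRN _ (- b)) lef_pV2 ?posrE ?(powR_gt0 _ cg0) ?(powR_gt0 _ s20)//.
  apply: ge0_ler_powR; rewrite ?nnegrE ?cs ?(ltW cg0) ?(ltW s20)//.
  by rewrite /b -mulNr divr_ge0// opprB subr_ge0.
Qed.

(** [c] is the constant implicit in the lower condition on [sigma^2]. [K] and [k] precede the
    spaces, the sample and the class, so they depend on [alpha], [L] and [c] alone. For [alpha < 1]
    the lower bound asks [sigma <= 1]: beyond 1 the class [C(sigma)] stops growing, whereas
    [sigma^(1 - alpha)] does not. *)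
Theorem theorem2p3 (R : realType) (alpha L c : R)
    (alpha_gt0 : 0 < alpha) (alpha_neq1 : alpha != 1)
    (L_gt0 : 0 < L) (c_gt0 : 0 < c) :
  (exists2 K : R, 0 < K &
    forall (d : measure_display) (T : measurableType d) (P : probability T R)
      (dW : measure_display) (W : measurableType dW) (Pr : probability W R)
      (n : nat) (X : 'I_n -> {RV Pr >-> T}) (C : set (set T)) (sigma : R),
    (0 < n)%N ->
    iid_with_law P X ->
    countable C -> (forall A, C A -> measurable A) ->
    0 < sigma -> c * n%:R `^ (- (alpha + 1)^-1) <= sigma ^+ 2 ->
    bracketing_entropy_bound P C L alpha ->
    ('E_Pr[sup_emp_process P X (subclass P C (sigma ^+ 2))]
       <= (K * rate alpha sigma n)%:E)%E)
  /\
  (exists2 k : R, 0 < k &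
    forall (d : measure_display) (T : measurableType d) (P : probability T R)
      (dW : measure_display) (W : measurableType dW) (Pr : probability W R)
      (n : nat) (X : 'I_n -> {RV Pr >-> T}) (C : set (set T)) (sigma : R),
    (0 < n)%N ->
    iid_with_law P X ->
    countable C -> (forall A, C A -> measurable A) ->
    0 < sigma -> c * n%:R `^ (- (alpha + 1)^-1) <= sigma ^+ 2 ->
    (alpha < 1 -> sigma <= 1) ->
    bracketing_entropy_bound P C L alpha ->
    covering_entropy_lower_bound P C L alpha ->
    ((k * rate alpha sigma n)%:E
       <= 'E_Pr[sup_emp_process P X (subclass P C (sigma ^+ 2))])%E).
Proof.
split.
  have [K K0 HK] := upper_bound alpha_gt0 alpha_neq1 L_gt0.
  by exists K => // d T P dW W Pr n X C sigma n0 iid _ mC s0 _; exact: HK.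
have [k k0 Hk] := lower_bound alpha_gt0 alpha_neq1 L_gt0 c_gt0.
exists k => // d T P dW W Pr n X C sigma n0 iid _ mC s0 cs s1 _.
exact: Hk.
Qed.
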